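(* Let $A$ be a discrete $p$-primary $G$-module with the trivial action and let $\vartheta:\Gamma\to\mathbb{Z}_p^\times$ be a continuous character with $\vartheta|_\Delta=\omega_\Delta^m$ for some $m\in\mathbb{Z}/(p-1)\mathbb{Z}$. Then there is an equivalence $$R\Gamma(G,A(\vartheta))\simeq\operatorname{fib}\Bigl(\gamma-\vartheta^{-1}(\gamma):e_{-m}\mathbb{X}(A)\longrightarrow e_{-m}\mathbb{X}(A)\Bigr)=\mathbb{C}_{\vartheta^{-1}}(A)$$ in $D^+(\mathrm{Mod}_p^{\mathrm{disc}})$.
   Context: Let $p$ be an odd prime, $S=\{p,\infty\}$, $\mathbb{Q}_S$ the maximal extension of $\mathbb{Q}$ unramified outside $S$, $G=\mathrm{Gal}(\mathbb{Q}_S/\mathbb{Q})$, $F_\infty=\mathbb{Q}(\mu_{p^\infty})=\bigcup_n\mathbb{Q}(\mu_{p^n})$, $H=\mathrm{Gal}(\mathbb{Q}_S/F_\infty)$, and $\Gamma=G/H=\mathrm{Gal}(F_\infty/\mathbb{Q})$. Let $\chi_\Gamma:\Gamma\xrightarrow{\sim}\mathbb{Z}_p^\times$ be the isomorphism induced by the cyclotomic character. Since $\mathbb{Z}_p^\times=\mu_{p-1}\times(1+p\mathbb{Z}_p)$, one has $\Gamma=\Delta\times\Gamma_1$, where $\Delta$ and $\Gamma_1$ correspond under $\chi_\Gamma$ to $\mu_{p-1}$ and $1+p\mathbb{Z}_p$. Let $\omega_\Delta=\chi_\Gamma|_\Delta:\Delta\to\mu_{p-1}\subset\mathbb{Z}_p^\times$.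 Fix a topological generator $\gamma$ of $\Gamma_1$. For a profinite group $K$, $\mathrm{Mod}_{K,p}^{\mathrm{disc}}$ is the abelian category of discrete $p$-primary abelian groups with continuous $K$-action, and $D^+(\mathrm{Mod}_{K,p}^{\mathrm{disc}})$ is its bounded-below derived $\infty$-category (realized by bounded-below complexes of injectives), a stable $\infty$-category; for $K=1$ write $\mathrm{Mod}_p^{\mathrm{disc}}$. For a closed normal subgroup $K'$ of $K$, $R\Gamma(K',-):D^+(\mathrm{Mod}_{K,p}^{\mathrm{disc}})\to D^+(\mathrm{Mod}_{K/K',p}^{\mathrm{disc}})$ is the right derived functor of $K'$-invariants. $\operatorname{fib}$ denotes the fiber in the stable $\infty$-category. For a continuous character $\vartheta:\Gamma\to\mathbb{Z}_p^\times$ and $M\in\mathrm{Mod}_{G,p}^{\mathrm{disc}}$, $M(\vartheta)$ is the same abelian group with $g\in G$ acting by $\vartheta(\bar g)$ times its original action, $\bar g$ being the image of $g$ in $\Gamma$. The universal cyclotomic complex is $\mathbb{X}(A):=R\Gamma(H,A)\in D^+(\mathrm{Mod}_{\Gamma,p}^{\mathrm{disc}})$. For $j\in\mathbb{Z}/(p-1)\mathbb{Z}$ put $e_j=\frac{1}{p-1}\sum_{\delta\in\Delta}\omega_\Delta^{-j}(\delta)[\delta]\in\mathbb{Z}_p[\Delta]$. The functor $M\mapsto e_jM$ is an exact endofunctor of $\mathrm{Mod}_{\Gamma,p}^{\mathrm{disc}}$ preserving injectives, and extends degreewise to an exact endofunctor $e_j$ of $D^+(\mathrm{Mod}_{\Gamma,p}^{\mathrm{disc}})$.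 After restricting to $\Gamma_1$ and forgetting the action, the action of $\gamma$ gives an endomorphism $\gamma$ of $e_j\mathbb{X}(A)$ in $D^+(\mathrm{Mod}_p^{\mathrm{disc}})$, and any $c\in\mathbb{Z}_p^\times$ gives the endomorphism ''multiplication by $c$''. Cyclotomic cone: for a continuous character $\theta:\Gamma\to\mathbb{Z}_p^\times$ with $\theta|_\Delta=\omega_\Delta^k$, $k\in\mathbb{Z}/(p-1)\mathbb{Z}$, define $\mathbb{C}_\theta(A):=\operatorname{fib}\bigl(\gamma-\theta(\gamma):e_k\mathbb{X}(A)\to e_k\mathbb{X}(A)\bigr)$ in $D^+(\mathrm{Mod}_p^{\mathrm{disc}})$. *)

(* Defs.v *)
From HB Require Import structures.
From mathcomp Require Import all_boot all_order all_algebra all_field finmap.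
From mathcomp Require Import all_classical topology_structure quotient_topology.
Set Implicit Arguments.
Unset Strict Implicit.
Unset Printing Implicit Defensive.
Import Order.TTheory GRing.Theory Num.Theory.

Local Open Scope classical_set_scope.
Local Open Scope ring_scope.

(* The ring Z_p as the inverse limit of the rings Z / p ^ n; an element is    *)
(* the sequence of its residues, each taken in the interval [0, p ^ n[.       *)

Definition is_padic (p : nat) (a : nat -> int) : Prop :=
  forall n, a n = (a n.+1 %% (p ^ n)%N%:Z)%Z.

Definition Zp (p : nat) : Type := {a : nat -> int | `[< is_padic p a >]}.

Lemma modz_dvdm (m d e : int) : (d %| e)%Z -> ((m %% e)%Z = m %[mod d])%Z.
Proof.
by move=> /dvdzP[k ->]; rewrite [in RHS](divz_eq m (k * d)) mulrA modzMDl.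
Qed.

Section PadicIntegers.
Variable p : nat.
Implicit Types (a b c : Zp p) (n : nat).

HB.instance Definition _ := Choice.on (Zp p).

Definition zres a n : int := sval a n.

Lemma zresP a n : zres a n = (zres a n.+1 %% (p ^ n)%N%:Z)%Z.
Proof. exact: (asboolW (svalP a)). Qed.

Lemma zres_mod a n : (zres a n %% (p ^ n)%N%:Z)%Z = zres a n.
Proof. by rewrite [in LHS]zresP modz_mod -zresP. Qed.

Lemma zres_le a m n : (m <= n)%N -> (zres a n %% (p ^ m)%N%:Z)%Z = zres a m.
Proof.
move=> /subnK <-; elim: (n - m)%N => [|k IH]; first by rewrite add0n zres_mod.
by rewrite -IH addSn (zresP a (k + m)) modz_dvdm // dvdzE /= dvdn_exp2l // leq_addl.
Qed.

Lemma zres_inj a b : (forall n, zres a n = zres b n) -> a = b.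
Proof. by move=> ab; apply: val_inj; apply/funext. Qed.

Definition mkZp (f : nat -> int)
    (hf : forall n, (f n.+1 = f n %[mod (p ^ n)%N%:Z])%Z) : Zp p.
Proof.
exists (fun n => (f n %% (p ^ n)%N%:Z)%Z); apply/asboolP => n.
by rewrite modz_dvdm ?hf // dvdzE /= dvdn_exp2l.
Defined.

Lemma zres_mk f hf n : zres (@mkZp f hf) n = (f n %% (p ^ n)%N%:Z)%Z.
Proof. by []. Qed.

Lemma zresS a n : (zres a n.+1 = zres a n %[mod (p ^ n)%N%:Z])%Z.
Proof. by rewrite -zresP zres_mod. Qed.

Definition zp_int (k : int) : Zp p := @mkZp (fun=> k) (fun=> erefl).

Fact zp_opp_subproof a n :
  (- zres a n.+1 = - zres a n %[mod (p ^ n)%N%:Z])%Z.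
Proof. by rewrite -modzNm zresS modzNm. Qed.
Definition zp_opp a := mkZp (zp_opp_subproof a).

Fact zp_add_subproof a b n :
  (zres a n.+1 + zres b n.+1 = zres a n + zres b n %[mod (p ^ n)%N%:Z])%Z.
Proof. by rewrite -modzDm !zresS modzDm. Qed.
Definition zp_add a b := mkZp (zp_add_subproof a b).

Fact zp_mul_subproof a b n :
  (zres a n.+1 * zres b n.+1 = zres a n * zres b n %[mod (p ^ n)%N%:Z])%Z.
Proof. by rewrite -modzMm !zresS modzMm. Qed.
Definition zp_mul a b := mkZp (zp_mul_subproof a b).

Fact zp_addA : associative zp_add.
Proof. by move=> a b c; apply: zres_inj => n; rewrite !zres_mk modzDml modzDmr addrA. Qed.
Fact zp_addC : commutative zp_add.
Proof. by move=> a b; apply: zres_inj => n; rewrite !zres_mk addrC. Qed.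
Fact zp_add0 : left_id (zp_int 0) zp_add.
Proof.
by move=> a; apply: zres_inj => n; rewrite !zres_mk modzDml add0r zres_mod.
Qed.
Fact zp_addN : left_inverse (zp_int 0) zp_opp zp_add.
Proof. by move=> a; apply: zres_inj => n; rewrite !zres_mk modzDml addNr. Qed.

HB.instance Definition _ :=
  GRing.isZmodule.Build (Zp p) zp_addA zp_addC zp_add0 zp_addN.

Fact zp_mulA : associative zp_mul.
Proof. by move=> a b c; apply: zres_inj => n; rewrite !zres_mk modzMml modzMmr mulrA. Qed.
Fact zp_mulC : commutative zp_mul.
Proof. by move=> a b; apply: zres_inj => n; rewrite !zres_mk mulrC. Qed.
Fact zp_mul1 : left_id (zp_int 1) zp_mul.
Proof.
by move=> a; apply: zres_inj => n; rewrite !zres_mk modzMml mul1r zres_mod.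
Qed.
Fact zp_mulDl : left_distributive zp_mul +%R.
Proof.
by move=> a b c; apply: zres_inj => n; rewrite !zres_mk modzMml modzDm mulrDl.
Qed.

HB.instance Definition _ :=
  GRing.Zmodule_isComPzRing.Build (Zp p) zp_mulA zp_mulC zp_mul1 zp_mulDl.

Lemma zresD a b n : zres (a + b) n = ((zres a n + zres b n) %% (p ^ n)%N%:Z)%Z.
Proof. by []. Qed.
Lemma zresM a b n : zres (a * b) n = ((zres a n * zres b n) %% (p ^ n)%N%:Z)%Z.
Proof. by []. Qed.
Lemma zres1 n : zres 1 n = (1 %% (p ^ n)%N%:Z)%Z.
Proof. by []. Qed.

Definition zp_open (U : set (Zp p)) : Prop :=
  forall a, U a -> exists n, forall b, zres b n = zres a n -> U b.

Fact zp_openT : zp_open setT. Proof. by move=> a _; exists 0%N. Qed.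
Fact zp_openI : setI_closed zp_open.
Proof.
move=> U V oU oV a [Ua Va]; have [m hm] := oU a Ua; have [n hn] := oV a Va.
exists (maxn m n) => b hb; split.
  by apply: hm; rewrite -(zres_le b (leq_maxl m n)) hb zres_le // leq_maxl.
by apply: hn; rewrite -(zres_le b (leq_maxr m n)) hb zres_le // leq_maxr.
Qed.
Fact zp_open_bigU (I : Type) (f : I -> set (Zp p)) :
  (forall i, zp_open (f i)) -> zp_open (\bigcup_i f i).
Proof.
move=> of_ a [i _ fia]; have [n hn] := of_ i a fia.
by exists n => b /hn fib; exists i.
Qed.

HB.instance Definition _ :=
  isOpenTopological.Build (Zp p) zp_openT zp_openI zp_open_bigU.

(* The inverse of a unit (and 0 on non-units).                                *)
Definition zp_inv a : Zp p := xget 0 [set b | a * b = 1].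

Lemma zp_invE a b : a * b = 1 -> zp_inv a = b.
Proof.
move=> ab; apply: xget_unique => // c ac.
by rewrite -[c]mul1r -ab [a * b]mulrC -mulrA ac mulr1.
Qed.

End PadicIntegers.

(* Groups with a topology.  The continuity of the group law, which holds for  *)
(* all the groups below, plays no role in the definitions.                    *)

#[short(type="topGroupType")]
HB.structure Definition TopGroup := {K of monoid.Group K & Topological K}.

Record normal_subgroup (K : topGroupType) := NormalSubgroup {
  nsub :> K -> Prop;
  nsub1 : nsub 1%g;
  nsubM : forall x y, nsub x -> nsub y -> nsub (x * y)%g;
  nsubV : forall x, nsub x -> nsub (x^-1)%g;
  nsubJ : forall x y, nsub x -> nsub (y^-1 * x * y)%g;
  nsub_closed : closed (nsub : set K)
}.

Definition total_subgroup (K : topGroupType) : normal_subgroup K.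
Proof. by apply: (@NormalSubgroup K setT) => //; exact: closedT. Defined.

Section QuotientGroup.
Variables (K : topGroupType) (N : normal_subgroup K).
Implicit Types x y z : K.

Definition coset_rel : rel K := fun x y => `[< N (x^-1 * y)%g >].

Fact coset_rel_refl : reflexive coset_rel.
Proof. by move=> x; apply/asboolP; rewrite mulVg; exact: nsub1. Qed.
Fact coset_rel_sym : symmetric coset_rel.
Proof.
have H x y : coset_rel x y -> coset_rel y x.
  by move=> /asboolP/nsubV h; apply/asboolP; rewrite invgM invgK in h.
by move=> x y; apply/idP/idP; apply: H.
Qed.
Fact coset_rel_trans : transitive coset_rel.
Proof.
move=> y x z /asboolP xy /asboolP yz; apply/asboolP.
by have := nsubM xy yz; rewrite mulgA mulgK.
Qed.

Canonical coset_equiv :=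
  EquivRel coset_rel coset_rel_refl coset_rel_sym coset_rel_trans.

Definition quotient_group : Type :=
  quotient_topology {eq_quot coset_equiv}%qT.

HB.instance Definition _ := Topological.on quotient_group.

Definition qproj (x : K) : quotient_group := (\pi x)%qT.
Definition qrepr (q : quotient_group) : K := repr q.

Lemma qreprK q : qproj (qrepr q) = q.
Proof. exact: reprK. Qed.

Lemma qprojP x y : qproj x = qproj y <-> N (x^-1 * y)%g.
Proof. by split=> [/eqquotP/asboolP | h]; last apply/eqquotP/asboolP. Qed.

Lemma qprojE x : exists2 h, N h & qrepr (qproj x) = (x * h)%g.
Proof.
exists (x^-1 * qrepr (qproj x))%g; last by rewrite mulVKg.
by apply/qprojP; rewrite qreprK.
Qed.

Definition q_mul (q r : quotient_group) := qproj (qrepr q * qrepr r)%g.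
Definition q_inv (q : quotient_group) := qproj (qrepr q)^-1%g.

Lemma q_mulE x y : q_mul (qproj x) (qproj y) = qproj (x * y)%g.
Proof.
rewrite /q_mul; have [h Nh ->] := qprojE x; have [k Nk ->] := qprojE y.
apply/esym/qprojP; rewrite invgM.
have -> : (y^-1 * x^-1 * (x * h * (y * k)) = (y^-1 * h * y) * k)%g.
  by rewrite !mulgA mulgVK.
by apply: nsubM => //; apply: nsubJ.
Qed.

Lemma q_invE x : q_inv (qproj x) = qproj (x^-1)%g.
Proof.
rewrite /q_inv; have [h Nh ->] := qprojE x; apply/qprojP.
have -> : ((x * h)^-1^-1 * x^-1 = x^-1^-1 * h * x^-1)%g by rewrite !invgK.
exact: nsubJ.
Qed.

Fact q_mulA : associative q_mul.
Proof.
by move=> q r s; rewrite -(qreprK q) -(qreprK r) -(qreprK s) !q_mulE mulgA.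
Qed.
Fact q_mul1 : left_id (qproj 1%g) q_mul.
Proof. by move=> q; rewrite -(qreprK q) q_mulE mul1g. Qed.
Fact q_mulr1 : right_id (qproj 1%g) q_mul.
Proof. by move=> q; rewrite -(qreprK q) q_mulE mulg1. Qed.
Fact q_mulV : left_inverse (qproj 1%g) q_inv q_mul.
Proof. by move=> q; rewrite -(qreprK q) q_invE q_mulE mulVg. Qed.
Fact q_mulrV : right_inverse (qproj 1%g) q_inv q_mul.
Proof. by move=> q; rewrite -(qreprK q) q_invE q_mulE mulgV. Qed.

HB.instance Definition _ :=
  isGroup.Build quotient_group q_mulA q_mul1 q_mulr1 q_mulV q_mulrV.

Lemma qproj1 : qproj 1%g = 1%g. Proof. by []. Qed.
Lemma qprojM x y : qproj (x * y)%g = (qproj x * qproj y)%g.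
Proof. exact/esym/q_mulE. Qed.
Lemma qproj_continuous : continuous qproj.
Proof. exact: pi_continuous. Qed.

End QuotientGroup.

(* Continuous characters K -> Z_p^*.                                          *)
Record zpchar (p : nat) (K : topGroupType) := ZpChar {
  zchar :> K -> Zp p;
  zchar1 : zchar 1%g = 1;
  zcharM : forall x y, zchar (x * y)%g = zchar x * zchar y;
  zchar_continuous : continuous zchar
}.

Section Characters.
Variables (p : nat).

Lemma zp_near (T : topologicalType) (f : T -> Zp p) :
  continuous f <-> forall n x, \forall y \near x, zres (f y) n = zres (f x) n.
Proof.
split=> [cf n x|h].
  have oU : open [set a : Zp p | zres a n = zres (f x) n].
    by move=> /= a an; exists n => b /= ->.
  apply: (cf x [set a : Zp p | zres a n = zres (f x) n]).
  exact: open_nbhs_nbhs.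
apply/continuousP => U oU; rewrite openE => x Ux.
have [n hn] := oU _ Ux; rewrite /interior; apply: filterS (h n x) => y.
exact: hn.
Qed.

Variables (K : topGroupType) (t : zpchar p K).

Lemma zcharV x : zp_inv (t x) = t x^-1%g.
Proof. by apply: zp_invE; rewrite -zcharM mulgV zchar1. Qed.

Fact zchar_inv1 : zp_inv (t 1%g) = 1.
Proof. by rewrite zcharV invg1 zchar1. Qed.
Fact zchar_invM x y : zp_inv (t (x * y)%g) = zp_inv (t x) * zp_inv (t y).
Proof. by rewrite !zcharV invgM zcharM mulrC. Qed.
Fact zchar_inv_continuous : continuous (fun x => zp_inv (t x)).
Proof.
apply: (proj2 (zp_near _)) => n x.
have := proj1 (zp_near _) (@zchar_continuous _ _ t) n x.
apply: filterS => y yx; rewrite !zcharV.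
have e z : ((zres (t z) n * zres (t z^-1%g) n) %% (p ^ n)%N%:Z)%Z
    = (1 %% (p ^ n)%N%:Z)%Z.
  by rewrite -zresM -zcharM mulgV zchar1 zres1.
rewrite -[LHS]zres_mod -[RHS]zres_mod -[zres _ _ in LHS]mulr1 -modzMmr -(e x).
rewrite modzMmr -yx mulrA [X in (X * _)%R]mulrC -modzMml e modzMml.
by rewrite mul1r.
Qed.

Definition zchar_inv : zpchar p K :=
  ZpChar zchar_inv1 zchar_invM zchar_inv_continuous.

End Characters.

(* Discrete p-primary abelian groups with continuous K-action; dmod_cont is   *)
(* the continuity of the action K x M -> M for the discrete topology on M.    *)
Record dmod (p : nat) (K : topGroupType) := DMod {
  dmod_car :> zmodType;
  dact : K -> dmod_car -> dmod_car;
  dact1 : forall m, dact 1%g m = m;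
  dactM : forall g h m, dact (g * h)%g m = dact g (dact h m);
  dactD : forall g m n, dact g (m + n) = dact g m + dact g n;
  dmod_cont : forall m g, \forall h \near g, dact h m = dact g m;
  dmod_primary : forall m : dmod_car, exists n : nat, m *+ (p ^ n) = 0
}.

Lemma mulrz_mod (V : zmodType) (m : V) (q : nat) (k : int) :
  m *+ q = 0 -> m *~ (k %% q%:Z)%Z = m *~ k.
Proof.
move=> mq; rewrite /modz mulrzBr [(k %/ q)%Z * _]mulrC mulrzA -pmulrn mq.
by rewrite mul0rz subr0.
Qed.

Section DMod.
Variables (p : nat) (K : topGroupType).
Implicit Types M N : dmod p K.

Lemma dactB M g (m n : M) : dact g (m - n) = dact g m - dact g n.
Proof. by rewrite -[in RHS](subrK n m) [in RHS]dactD addrK. Qed.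

Lemma dact0 M g : dact g (0 : M) = 0.
Proof. by rewrite -[in LHS](subrr 0) dactB subrr. Qed.

Lemma dactMn M g (m : M) n : dact g (m *+ n) = dact g m *+ n.
Proof. by elim: n => [|n IH]; rewrite ?mulr0n ?dact0 // !mulrS dactD IH. Qed.

Lemma dactMz M g (m : M) k : dact g (m *~ k) = dact g m *~ k.
Proof.
case: k => n; first exact: dactMn.
by rewrite !NegzE !mulrNz -[in LHS]sub0r dactB dact0 sub0r; congr (- _); exact: dactMn.
Qed.

Record dhom M N := DHom {
  dfun :> M -> N;
  dfunD : forall m n, dfun (m + n) = dfun m + dfun n;
  dfun_act : forall g m, dfun (dact g m) = dact g (dfun m)
}.

Lemma dfunB M N (f : dhom M N) m n : f (m - n) = f m - f n.
Proof. by rewrite -[in RHS](subrK n m) [in RHS]dfunD addrK. Qed.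
Lemma dfun0 M N (f : dhom M N) : f 0 = 0.
Proof. by rewrite -[in LHS](subrr 0) dfunB subrr. Qed.
Lemma dfunMn M N (f : dhom M N) m n : f (m *+ n) = f m *+ n.
Proof. by elim: n => [|n IH]; rewrite ?mulr0n ?dfun0 // !mulrS dfunD IH. Qed.
Lemma dfunMz M N (f : dhom M N) m k : f (m *~ k) = f m *~ k.
Proof.
case: k => n; first exact: dfunMn.
by rewrite !NegzE !mulrNz -[in LHS]sub0r dfunB dfun0 sub0r; congr (- _); exact: dfunMn.
Qed.

Definition dinjective (I : dmod p K) : Prop :=
  forall (M N : dmod p K) (i : dhom M N) (f : dhom M I),
    injective i -> exists g : dhom N I, forall m, g (i m) = f m.

(* The action of Z_p on M: if p ^ n kills m then a acts on m as a mod p ^ n.  *)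
Definition zscale M (a : Zp p) (m : M) : M :=
  m *~ zres a (sval (cid (dmod_primary m))).

Lemma zscaleE M (a : Zp p) (m : M) n : m *+ p ^ n = 0 ->
  zscale a m = m *~ zres a n.
Proof.
rewrite /zscale; case: cid => /= k hk hn.
have E i j : (i <= j)%N -> m *+ p ^ i = 0 -> m *~ zres a j = m *~ zres a i.
  by move=> ij hi; rewrite -(zres_le a ij) mulrz_mod.
by have [/E->|/ltnW/E->] := leqP n k.
Qed.

Lemma zscaleD M (a : Zp p) (m n : M) : zscale a (m + n) = zscale a m + zscale a n.
Proof.
have [k hk] := dmod_primary m; have [l hl] := dmod_primary n.
have hk' : m *+ p ^ (k + l) = 0 by rewrite expnD mulrnA hk mul0rn.
have hl' : n *+ p ^ (k + l) = 0 by rewrite addnC expnD mulrnA hl mul0rn.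
by rewrite !(@zscaleE _ _ _ (k + l)) ?mulrnDl ?hk' ?hl' ?addr0 // mulrzDl.
Qed.

Lemma zscaleA M (a b : Zp p) (m : M) : zscale (a * b) m = zscale a (zscale b m).
Proof.
have [k hk] := dmod_primary m; have hb : zscale b m *+ p ^ k = 0.
  by rewrite (zscaleE _ hk) pmulrn mulrzAC -pmulrn hk mul0rz.
rewrite (zscaleE _ hk) (zscaleE _ hb) (zscaleE _ hk) zresM mulrz_mod //.
by rewrite mulrC mulrzA.
Qed.

Lemma zscale1 M (m : M) : zscale 1 m = m.
Proof.
have [k hk] := dmod_primary m.
by rewrite (zscaleE _ hk) zres1 mulrz_mod // mulr1z.
Qed.

Lemma zscale_dfun M N (f : dhom M N) a m : f (zscale a m) = zscale a (f m).
Proof.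
have [k hk] := dmod_primary m.
by rewrite (zscaleE _ hk) dfunMz (@zscaleE _ _ _ k) // -dfunMn hk dfun0.
Qed.

Lemma zscale_dact M g a (m : M) : dact g (zscale a m) = zscale a (dact g m).
Proof.
have [k hk] := dmod_primary m.
by rewrite (zscaleE _ hk) dactMz (@zscaleE _ _ _ k) // -dactMn hk dact0.
Qed.

Definition dzero : dmod p K.
Proof.
refine (@DMod p K 'I_1 (fun (_ : K) (m : 'I_1) => m) _ _ _ _ _) => //.
- by move=> m g; exact: nearW.
- by move=> m; exists 0%N; rewrite !ord1.
Defined.

Definition dsum M N : dmod p K.
Proof.
refine (@DMod p K (M * N)%type (fun g m => (dact g m.1, dact g m.2)) _ _ _ _ _).
- by case=> m n /=; rewrite !dact1.
- by move=> g h [m n] /=; rewrite !dactM.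
- by move=> g [m n] [m' n'] /=; rewrite !dactD.
- case=> m n g /=; have := dmod_cont m g; apply: filterS2 (dmod_cont n g).
  by move=> h /= -> ->.
- case=> m n; have [k hk] := dmod_primary m; have [l hl] := dmod_primary n.
  exists (k + l)%N; have -> i : (m, n) *+ i = (m *+ i, n *+ i) :> M * N.
    by elim: i => // i IH; rewrite !mulrS IH.
  by rewrite expnD {1}mulrnA hk mul0rn mulnC mulrnA hl mul0rn.
Defined.

End DMod.

Record subgrp (V : zmodType) := SubGrp {
  sgrp :> V -> Prop;
  sgrp0 : sgrp 0;
  sgrpB : forall x y, sgrp x -> sgrp y -> sgrp (x - y)
}.

Section SubGrp.
Variables (V : zmodType) (S : subgrp V).

Definition sgrp_pred : {pred V} := fun x => `[< S x >].
Fact sgrp_closed : zmod_closed sgrp_pred.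
Proof.
split; first exact/asboolP/sgrp0.
by move=> x y /asboolP Sx /asboolP Sy; apply/asboolP/sgrpB.
Qed.
HB.instance Definition _ := GRing.isZmodClosed.Build V sgrp_pred sgrp_closed.

Definition sgrp_type : Type := {x : V | x \in sgrp_pred}.
HB.instance Definition _ := SubChoice.on sgrp_type.
HB.instance Definition _ := [SubChoice_isSubZmodule of sgrp_type by <:].

Definition sgrp_in x (Sx : S x) : sgrp_type := exist _ x (asboolT Sx).
Lemma sgrpP (x : sgrp_type) : S (val x).
Proof. exact: (asboolW (valP x)). Qed.
Lemma sgrp_eq (x y : sgrp_type) : val x = val y -> x = y.
Proof. exact: val_inj. Qed.
Lemma sgrp_valD (x y : sgrp_type) : val (x + y) = val x + val y.
Proof. by []. Qed.
Lemma sgrp_valMn (x : sgrp_type) n : val (x *+ n) = val x *+ n.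
Proof. by elim: n => // n IH; rewrite !mulrS sgrp_valD IH. Qed.

End SubGrp.

(* The K/N-module M^N of N-invariants; a coset acts through any of its        *)
(* representatives.                                                           *)
Section Invariants.
Variables (p : nat) (K : topGroupType) (N : normal_subgroup K).

Definition inv_subgrp (M : dmod p K) : subgrp M.
Proof.
apply: (@SubGrp M (fun m => forall h, N h -> dact h m = m)).
  by move=> h _; rewrite dact0.
by move=> x y hx hy h Nh; rewrite dactB hx ?hy.
Defined.

Section Obj.
Variable M : dmod p K.

Fact inv_act_subproof (q : quotient_group N) (m : sgrp_type (inv_subgrp M)) :
  inv_subgrp M (dact (qrepr q) (val m)).
Proof.
move=> h Nh; rewrite -dactM.
have -> : (h * qrepr q = qrepr q * ((qrepr q)^-1 * h * qrepr q))%g.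
  by rewrite !mulgA mulgV mul1g.
by rewrite dactM (sgrpP m) //; exact: nsubJ.
Qed.

Definition inv_act q m := sgrp_in (@inv_act_subproof q m).

Lemma inv_actE x (m : sgrp_type (inv_subgrp M)) :
  val (inv_act (qproj N x) m) = dact x (val m).
Proof. by rewrite /=; have [h Nh ->] := qprojE N x; rewrite dactM (sgrpP m). Qed.

Definition invariants : dmod p (quotient_group N).
Proof.
refine (@DMod p (quotient_group N) (sgrp_type (inv_subgrp M)) inv_act _ _ _ _ _).
- by move=> m; apply: sgrp_eq; rewrite -(qproj1 N) inv_actE dact1.
- move=> g h m; apply: sgrp_eq; rewrite -(qreprK g) -(qreprK h) -qprojM.
  by rewrite !inv_actE dactM.
- by move=> g m n; apply: sgrp_eq; rewrite /= dactD.
- move=> m q.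
  have oU : open [set r : quotient_group N | inv_act r m = inv_act q m].
    suff oV : open [set x : K | dact x (val m) = dact (qrepr q) (val m)].
      congr (open _): oV; apply/seteqP; split=> x /= hx.
        by apply: sgrp_eq; rewrite inv_actE hx.
      by rewrite -[LHS]inv_actE hx.
    rewrite openE => x /= hx; rewrite /interior.
    by apply: filterS (dmod_cont (val m) x) => y; rewrite /= hx.
  exact: open_nbhs_nbhs.
- move=> m; have [n hn] := dmod_primary (val m); exists n.
  by apply: sgrp_eq; rewrite sgrp_valMn.
Defined.

End Obj.

Fact inv_hom_subproof (M M' : dmod p K) (f : dhom M M') (m : invariants M) :
  inv_subgrp M' (f (val m)).
Proof. by move=> h Nh; rewrite -dfun_act (sgrpP m). Qed.

Definition inv_hom (M M' : dmod p K) (f : dhom M M') :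
  dhom (invariants M) (invariants M').
Proof.
apply: (@DHom _ _ (invariants M) (invariants M')
  (fun m => sgrp_in (inv_hom_subproof f m))).
  by move=> m n; apply: sgrp_eq; rewrite /= dfunD.
by move=> g m; apply: sgrp_eq; rewrite /= dfun_act.
Defined.

End Invariants.

Section Image.
Variables (p : nat) (K : topGroupType) (M : dmod p K) (e : dhom M M).

Definition image_subgrp : subgrp M.
Proof.
apply: (@SubGrp M (fun m => exists n, m = e n)).
  by exists 0; rewrite dfun0.
by move=> _ _ [m ->] [n ->]; exists (m - n); rewrite dfunB.
Defined.

Fact image_act_subproof g (m : sgrp_type image_subgrp) :
  image_subgrp (dact g (val m)).
Proof. by have [n ->] := sgrpP m; exists (dact g n); rewrite dfun_act. Qed.

Definition dimage : dmod p K.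
Proof.
refine (@DMod p K (sgrp_type image_subgrp)
  (fun g m => sgrp_in (image_act_subproof g m)) _ _ _ _ _).
- by move=> m; apply: sgrp_eq; rewrite /= dact1.
- by move=> g h m; apply: sgrp_eq; rewrite /= dactM.
- by move=> g m n; apply: sgrp_eq; rewrite /= dactD.
- move=> m g; apply: filterS (dmod_cont (val m) g) => h hm.
  exact: sgrp_eq.
- move=> m; have [n hn] := dmod_primary (val m); exists n.
  by apply: sgrp_eq; rewrite sgrp_valMn.
Defined.
End Image.

Section ImageHom.
Variables (p : nat) (K : topGroupType) (M M' : dmod p K).
Variables (e : dhom M M) (e' : dhom M' M') (f : dhom M M').
Hypothesis fe : forall m, f (e m) = e' (f m).

Fact image_hom_subproof (m : dimage e) : image_subgrp e' (f (val m)).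
Proof. by have [n ->] := sgrpP m; exists (f n). Qed.

Definition image_hom : dhom (dimage e) (dimage e').
Proof.
apply: (@DHom _ _ (dimage e) (dimage e')
  (fun m => sgrp_in (image_hom_subproof m))).
  by move=> m n; apply: sgrp_eq; rewrite /= dfunD.
by move=> g m; apply: sgrp_eq; rewrite /= dfun_act.
Defined.
End ImageHom.

(* The trivial group; dmod p trivial_group is the category Mod_p^disc.        *)
Definition trivial_group : Type := unit.
HB.instance Definition _ := Choice.on trivial_group.
HB.instance Definition _ := isGroup.Build trivial_group
  (one := tt) (inv := fun=> tt) (mul := fun _ _ => tt)
  (fun _ _ _ => erefl) (fun x => let: tt := x in erefl)
  (fun x => let: tt := x in erefl) (fun=> erefl) (fun=> erefl).
HB.instance Definition _ := isOpenTopological.Build trivial_group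
  (op := setT) I (fun _ _ _ _ => I) (fun _ _ _ => I).

Section Forget.
Variables (p : nat) (K : topGroupType).

Definition forget (M : dmod p K) : dmod p trivial_group.
Proof.
refine (@DMod p trivial_group M (fun _ m => m) _ _ _ _ _); do ?by [].
- by move=> m g; apply: filterE.
- exact: dmod_primary.
Defined.

Definition forget_hom (M M' : dmod p K) (f : dhom M M') :
  dhom (forget M) (forget M').
Proof.
apply: (@DHom _ _ (forget M) (forget M') f); last by [].
exact: (dfunD f).
Defined.
End Forget.

(* The twist M(t) of a K-module by a character t of K/N.                      *)
Section Twist.
Variables (p : nat) (K : topGroupType) (N : normal_subgroup K).
Variables (t : zpchar p (quotient_group N)) (M : dmod p K).

Definition twist : dmod p K.
Proof.
refine (@DMod p K M (fun g m => zscale (t (qproj N g)) (dact g m)) _ _ _ _ _).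
- by move=> m; rewrite qproj1 zchar1 dact1 zscale1.
- by move=> g h m; rewrite qprojM zcharM zscaleA dactM zscale_dact.
- by move=> g m n; rewrite dactD zscaleD.
- move=> m g; have [k hk] := dmod_primary m.
  have hg x : dact x m *+ p ^ k = 0 by rewrite -dactMn hk dact0.
  have ct : continuous (fun x => t (qproj N x)).
    move=> x; apply: (@continuous_comp _ _ _ (qproj N) t).
      exact: qproj_continuous.
    exact: zchar_continuous.
  have := proj1 (zp_near _) ct k g; apply: filterS2 (dmod_cont m g) => h hm ht.
  by rewrite !(zscaleE _ (hg _)) hm ht.
- exact: dmod_primary.
Defined.
End Twist.

(* Bounded below cochain complexes; the differential cd n ends in degree n.   *)
Record cplx (p : nat) (K : topGroupType) := Cplx {
  cobj :> int -> dmod p K;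
  cd : forall n, dhom (cobj (n - 1)) (cobj n);
  cdd : forall n x, cd n (cd (n - 1) x) = 0;
  cbounded : exists n0, forall n, n < n0 -> forall x : cobj n, x = 0
}.

Record cmap (p : nat) (K : topGroupType) (X Y : cplx p K) := CMap {
  cfun :> forall n, dhom (X n) (Y n);
  cfun_d : forall n x, cfun n (cd X n x) = cd Y n (cfun (n - 1) x)
}.

(* f induces a bijection on H^(n-1) for all n.                                *)
Definition quasi_iso (p : nat) (K : topGroupType) (X Y : cplx p K)
    (f : cmap X Y) : Prop :=
  forall n,
    (forall x, cd X n x = 0 ->
       (exists y, f (n - 1) x = cd Y (n - 1) y) ->
       exists x', x = cd X (n - 1) x') /\
    (forall y, cd Y n y = 0 ->
       exists2 x, cd X n x = 0 & exists y', y = f (n - 1) x + cd Y (n - 1) y').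

(* X and Y are isomorphic in the derived category, i.e. equivalent objects of *)
(* the derived infinity-category.                                             *)
Definition derived_equiv (p : nat) (K : topGroupType) (X Y : cplx p K) : Prop :=
  exists (Z : cplx p K) (f : cmap X Z) (g : cmap Y Z),
    quasi_iso f /\ quasi_iso g.

(* The fiber of f: X -> Y, i.e. the mapping cone of f shifted by -1.          *)
Section Fiber.
Variables (p : nat) (K : topGroupType) (X Y : cplx p K) (f : cmap X Y).

Definition fib_d n : dhom (dsum (X (n - 1)) (Y (n - 1 - 1)))
                          (dsum (X n) (Y (n - 1))).
Proof.
apply: (@DHom _ _ (dsum (X (n - 1)) (Y (n - 1 - 1))) (dsum (X n) (Y (n - 1)))
  (fun u => (cd X n u.1, f (n - 1) u.1 - cd Y (n - 1) u.2))).
  case=> x y [x' y'] /=; rewrite !dfunD; congr (_, _).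
  by rewrite opprD addrACA.
by move=> g [x y] /=; rewrite !dfun_act -dactB.
Defined.

Definition fib : cplx p K.
Proof.
refine (@Cplx p K (fun n => dsum (X n) (Y (n - 1))) fib_d _ _).
  move=> n [x y] /=; rewrite cdd cfun_d dfunB cdd subr0 subrr.
  by [].
have [a ha] := cbounded X; have [b hb] := cbounded Y.
exists (Order.min a b) => n; rewrite lt_min => /andP[na nb] [x y].
rewrite (ha n na x) (hb (n - 1) _ y) //.
by apply: le_lt_trans nb; rewrite gerBl.
Defined.
End Fiber.

Section Single.
Variables (p : nat) (K : topGroupType).

Definition dhom0 (M N : dmod p K) : dhom M N.
Proof.
by apply: (@DHom _ _ M N (fun=> 0)) => *; rewrite ?addr0 ?dact0.
Defined.

Definition single (M : dmod p K) : cplx p K.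
Proof.
refine (@Cplx p K (fun n => if n is Posz 0 then M else dzero p K)
          (fun n => dhom0 _ _) _ _) => //.
by exists 0; case=> // n _ x; rewrite (ord1 (x : 'I_1)).
Defined.
End Single.

Section Functors.
Variables (p : nat) (K : topGroupType).
Implicit Types X : cplx p K.

Definition invariants_cplx (N : normal_subgroup K) X :
  cplx p (quotient_group N).
Proof.
refine (@Cplx _ _ (fun n => invariants N (X n)) (fun n => inv_hom N (cd X n)) _ _).
  by move=> n x; apply: sgrp_eq; exact: cdd.
have [a ha] := cbounded X; exists a => n na x.
by apply: sgrp_eq; exact: ha.
Defined.

Definition forget_cplx X : cplx p trivial_group.
Proof.
refine (@Cplx _ _ (fun n => forget (X n)) (fun n => forget_hom (cd X n)) _ _).
  by move=> n x; exact: cdd.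
have [a ha] := cbounded X; exists a => n na x; exact: ha.
Defined.

End Functors.

(* An injective resolution of X, and the model of RGamma(N, X) it computes.   *)
Record injective_resolution (p : nat) (K : topGroupType) (X : cplx p K) :=
  InjectiveResolution {
    ires :> cplx p K;
    ires_map : cmap X ires;
    ires_quasi_iso : quasi_iso ires_map;
    ires_injective : forall n, dinjective (ires n)
  }.

Definition RGamma (p : nat) (K : topGroupType) (N : normal_subgroup K)
    (X : cplx p K) (J : injective_resolution X) : cplx p (quotient_group N) :=
  invariants_cplx N J.

Section NumberField.
Variable F : fieldExtType rat.
Implicit Types I J P : set F.

Definition ring_of_integers : set F := [set x | integralOver (intr : int -> F) x].

Definition is_ideal I : Prop :=
  [/\ I `<=` ring_of_integers, I 0,
      forall x y, I x -> I y -> I (x + y) &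
      forall a x, ring_of_integers a -> I x -> I (a * x)].

Definition is_prime_ideal P : Prop :=
  [/\ is_ideal P, ~ P 1 &
      forall x y, ring_of_integers x -> ring_of_integers y ->
        P (x * y) -> P x \/ P y].

Definition ideal_mul I J : set F :=
  [set x | exists n (a b : 'I_n -> F),
     (forall i, I (a i) /\ J (b i)) /\ x = \sum_(i < n) a i * b i].

Definition ideal_exp I (n : nat) : set F := iter n (ideal_mul I) ring_of_integers.

(* e is the exponent of P in the factorization of the ideal generated by l.   *)
Definition ramification_index P (l e : nat) : Prop :=
  ideal_exp P e l%:R /\ ~ ideal_exp P e.+1 l%:R.

Definition unramified_at (l : nat) : Prop :=
  forall P, is_prime_ideal P -> P l%:R -> ramification_index P l 1.

(* Unramified outside {p, oo}; the archimedean place imposes no condition.    *)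
Definition unramified_outside (p : nat) : Prop :=
  forall l, prime l -> l <> p -> unramified_at l.

End NumberField.

Definition subfield_gen (L : fieldType) (S : set L) : {pred L} :=
  fun x => `[< forall E : {pred L}, divring_closed E ->
                 (forall y, S y -> y \in E) -> x \in E >].

Section SubfieldGen.
Variables (L : fieldType) (S : set L).

Lemma subfield_gen_closed : divring_closed (subfield_gen S).
Proof.
split.
- by apply/asboolP => E [].
- move=> x y /asboolP hx /asboolP hy; apply/asboolP => E cE SE.
  by have [_ sub _] := cE; apply: sub; [exact: hx|exact: hy].
- move=> x y /asboolP hx /asboolP hy; apply/asboolP => E cE SE.
  by have [_ _ div] := cE; apply: div; [exact: hx|exact: hy].
Qed.

Lemma subfield_gen_sub y : S y -> y \in subfield_gen S.
Proof. by move=> Sy; apply/asboolP => E _; apply. Qed.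

Lemma subfield_gen_min (E : {pred L}) x : divring_closed E ->
  (forall y, S y -> y \in E) -> x \in subfield_gen S -> x \in E.
Proof. by move=> cE SE /asboolP; apply. Qed.

End SubfieldGen.

(* Q_S for S = {p, oo}: the compositum, inside the algebraic closure algC of  *)
(* Q, of all the number fields that are unramified outside S.                 *)
Definition unramified_elts (p : nat) : set algC :=
  [set x | exists (F : fieldExtType rat) (i : {rmorphism F -> algC}),
     unramified_outside F p /\ exists y, x = i y].

Definition QS_pred (p : nat) : {pred algC} := subfield_gen (unramified_elts p).

HB.instance Definition _ p :=
  GRing.isDivringClosed.Build algC (QS_pred p) (subfield_gen_closed _).

Definition QS (p : nat) : Type := {x : algC | x \in QS_pred p}.

HB.instance Definition _ p := SubChoice.on (QS p).
HB.instance Definition _ p := [SubChoice_isSubIntegralDomain of QS p by <:].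
HB.instance Definition _ p := [SubIntegralDomain_isSubField of QS p by <:].

(* Gal(L / Q), with the Krull topology, as the group of all the field         *)
(* automorphisms of L.                                                        *)
Section Galois.
Variable L : fieldType.

Definition is_field_aut (f : L -> L) : Prop :=
  [/\ forall x y, f (x + y) = f x + f y,
      forall x y, f (x * y) = f x * f y,
      f 1 = 1 & bijective f].

Definition gal_group : Type := {f : L -> L | `[< is_field_aut f >]}.
HB.instance Definition _ := Choice.on gal_group.

Definition mk_gal (f : L -> L) (hf : is_field_aut f) : gal_group :=
  exist _ f (asboolT hf).
Definition gal_fun (s : gal_group) : L -> L := sval s.
Coercion gal_fun : gal_group >-> Funclass.

Lemma galP (s : gal_group) : is_field_aut s.
Proof. exact: (asboolW (svalP s)). Qed.
Lemma gal_eq (s t : gal_group) : s =1 t -> s = t.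
Proof. by move=> st; apply: val_inj; apply/funext. Qed.

Fact gal_one_subproof : is_field_aut id.
Proof. by split=> //; exists id. Qed.
Definition gal_one : gal_group := mk_gal gal_one_subproof.

Fact gal_mul_subproof (s t : gal_group) : is_field_aut (fun x => s (t x)).
Proof.
have [sD sM s1 sb] := galP s; have [tD tM t1 tb] := galP t; split.
- by move=> x y; rewrite tD sD.
- by move=> x y; rewrite tM sM.
- by rewrite t1 s1.
- exact: (bij_comp sb tb).
Qed.
Definition gal_mul s t : gal_group := mk_gal (gal_mul_subproof s t).

Lemma gal_inv_ex (s : gal_group) :
  exists g : L -> L, [/\ cancel s g, cancel g s & is_field_aut g].
Proof.
have [sD sM s1 [g sg gs]] := galP s; exists g; split=> //; split.
- by move=> x y; rewrite -[x in LHS]gs -[y in LHS]gs -sD sg.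
- by move=> x y; rewrite -[x in LHS]gs -[y in LHS]gs -sM sg.
- by rewrite -[1 in LHS]s1 sg.
- by exists s.
Qed.
Fact gal_inv_subproof (s : gal_group) : is_field_aut (sval (cid (gal_inv_ex s))).
Proof. by case: cid => g []. Qed.
Definition gal_inv s : gal_group := mk_gal (gal_inv_subproof s).

Lemma gal_invK (s : gal_group) x : gal_inv s (s x) = x.
Proof. by rewrite /gal_fun /=; case: cid => g [/= sg _ _]; exact: sg. Qed.
Lemma gal_invKV (s : gal_group) x : s (gal_inv s x) = x.
Proof. by rewrite {2}/gal_fun /=; case: cid => g [/= _ gs _]; exact: gs. Qed.

Fact gal_mulA : associative gal_mul. Proof. by move=> s t u; exact: gal_eq. Qed.
Fact gal_mul1 : left_id gal_one gal_mul. Proof. by move=> s; exact: gal_eq. Qed.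
Fact gal_mulr1 : right_id gal_one gal_mul. Proof. by move=> s; exact: gal_eq. Qed.
Fact gal_mulV : left_inverse gal_one gal_inv gal_mul.
Proof. by move=> s; apply: gal_eq => x; exact: gal_invK. Qed.
Fact gal_mulrV : right_inverse gal_one gal_inv gal_mul.
Proof. by move=> s; apply: gal_eq => x; exact: gal_invKV. Qed.

HB.instance Definition _ :=
  isGroup.Build gal_group gal_mulA gal_mul1 gal_mulr1 gal_mulV gal_mulrV.

Definition gal_open (U : set gal_group) : Prop :=
  forall s, U s -> exists E : seq L,
    forall t : gal_group, (forall x, x \in E -> t x = s x) -> U t.

Fact gal_openT : gal_open setT. Proof. by move=> s _; exists [::]. Qed.
Fact gal_openI : setI_closed gal_open.
Proof.
move=> U V oU oV s [Us Vs]; have [E hE] := oU s Us; have [E' hE'] := oV s Vs.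
exists (E ++ E') => t ht; split; [apply: hE|apply: hE'] => x xE;
  by apply: ht; rewrite mem_cat xE ?orbT.
Qed.
Fact gal_open_bigU (I : Type) (f : I -> set gal_group) :
  (forall i, gal_open (f i)) -> gal_open (\bigcup_i f i).
Proof.
move=> of_ s [i _ fis]; have [E hE] := of_ i s fis.
by exists E => t /hE fit; exists i.
Qed.
HB.instance Definition _ :=
  isOpenTopological.Build gal_group gal_openT gal_openI gal_open_bigU.

Lemma gal_mulE (s t : gal_group) x : gal_fun (s * t)%g x = s (t x). Proof. by []. Qed.
Lemma gal_1E x : gal_fun 1%g x = x. Proof. by []. Qed.
Lemma galD (s : gal_group) x y : s (x + y) = s x + s y.
Proof. by have [] := galP s. Qed.
Lemma galM (s : gal_group) x y : s (x * y) = s x * s y.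
Proof. by have [] := galP s. Qed.
Lemma gal1 (s : gal_group) : s 1 = 1.
Proof. by have [] := galP s. Qed.
Lemma galB (s : gal_group) x y : s (x - y) = s x - s y.
Proof. by rewrite -[in RHS](subrK y x) [in RHS]galD addrK. Qed.
Lemma gal0 (s : gal_group) : s 0 = 0.
Proof. by rewrite -[in LHS](subrr 0) galB subrr. Qed.
Lemma galV (s : gal_group) x : s x^-1 = (s x)^-1.
Proof.
have [->|x0] := eqVneq x 0; first by rewrite gal0 invr0 gal0.
have sx0 : s x != 0.
  apply: contra_neq x0 => sx0; rewrite -(gal_invK s x) sx0; exact: gal0.
by apply: (mulfI sx0); rewrite -galM !mulfV // gal1.
Qed.
Lemma galX (s : gal_group) x n : s (x ^+ n) = s x ^+ n.
Proof. by elim: n => [|n IH]; rewrite ?expr0 ?gal1 // !exprS galM IH. Qed.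

End Galois.

Section Cyclotomic.
Variable p : nat.

Local Notation G := (gal_group (QS p)).

(* The roots of unity of p-power order.  Q_S contains all those of algC,      *)
(* because the fields Q(mu_(p^n)) are unramified outside {p, oo}.             *)
Definition mu_p_infty : set (QS p) :=
  [set z | exists n : nat, (p ^ n)%N.-primitive_root z].

Definition F_infty : {pred QS p} := subfield_gen mu_p_infty.

HB.instance Definition _ :=
  GRing.isDivringClosed.Build (QS p) F_infty (subfield_gen_closed _).

Lemma mu_gal_power (s : G) z m : m.-primitive_root z ->
  exists k, s z = z ^+ k.
Proof.
move=> zm; have szm : s z ^+ m = 1 by rewrite -galX (prim_expr_order zm) gal1.
by have [k ->] := prim_rootP zm szm; exists k.
Qed.

Lemma F_infty_gal (s : G) x : x \in F_infty -> s x \in F_infty.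
Proof.
move=> xF; pose E : {pred QS p} := fun y => s y \in F_infty.
suff : x \in E by [].
apply: subfield_gen_min xF.
- split; first by rewrite unfold_in /E gal1 rpred1.
  + by move=> y z Ey Ez; rewrite unfold_in /E galB rpredB.
  + by move=> y z Ey Ez; rewrite unfold_in /E galM galV rpred_div.
- move=> y my; have [n yn] := my; rewrite unfold_in /E.
  by have [k ->] := mu_gal_power s yn; rewrite rpredX // subfield_gen_sub.
Qed.

(* Gal(Q_S / F_infty).                                                        *)
Definition galH : normal_subgroup G.
Proof.
apply: (@NormalSubgroup G (fun s : G => forall x, x \in F_infty -> s x = x)).
- by [].
- by move=> s t hs ht x xF; rewrite gal_mulE ht ?hs.
- by move=> s hs x xF; rewrite -[x in LHS]hs //; exact: gal_invK.
- move=> s t hs x xF; rewrite !gal_mulE hs; last exact: F_infty_gal.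
  exact: gal_invK.
- rewrite -openC; suff: gal_open (~` (fun s : G =>
    forall x, x \in F_infty -> s x = x)) by [].
  move=> s /= /existsNP [x /not_implyP [xF sx]].
  by exists [:: x] => t tx ht; apply: sx; rewrite -tx ?mem_head ?ht.
Defined.

Definition Gamma : topGroupType := quotient_group galH.

Lemma mu_gal_comm (s t : G) z : mu_p_infty z -> s (t z) = t (s z).
Proof.
case=> n zn; have [k sz] := mu_gal_power s zn; have [l tz] := mu_gal_power t zn.
by rewrite tz sz !galX sz tz -!exprM mulnC.
Qed.

Lemma gal_comm (s t : G) x : x \in F_infty -> s (t x) = t (s x).
Proof.
move=> xF.
pose E : {pred QS p} := fun y => s (t y) == t (s y).
suff : x \in E by move/eqP.
apply: subfield_gen_min xF; last by move=> y /(mu_gal_comm s t)/eqP.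
split; first by rewrite unfold_in /E !gal1.
- move=> y z /eqP hy /eqP hz; apply/eqP.
  by rewrite !galB hy hz.
- move=> y z /eqP hy /eqP hz; apply/eqP.
  by rewrite !(galM, galV) hy hz.
Qed.

Lemma Gamma_comm (g h : Gamma) : (g * h = h * g)%g.
Proof.
rewrite -(qreprK g) -(qreprK h) -!qprojM; apply/qprojP => x xF.
rewrite gal_mulE (gal_mulE (qrepr h)) (gal_comm (qrepr h)) //.
exact: (gal_invK (qrepr g * qrepr h)%g x).
Qed.

(* The cyclotomic character: s z = z ^ (chi s) for every z in mu_(p^oo).      *)
Definition cyclotomic_char (s : G) : Zp p :=
  xget 0 [set a : Zp p | forall n z, (p ^ n)%N.-primitive_root z ->
            s z = z ^ zres a n].

Definition chi_Gamma (g : Gamma) : Zp p := cyclotomic_char (qrepr g).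

(* The parts of Gamma that correspond to mu_(p-1) and to 1 + p Z_p.           *)
Definition Delta : set Gamma := [set g | chi_Gamma g ^+ p.-1 = 1].
Definition Gamma1 : set Gamma :=
  [set g | exists a : Zp p, chi_Gamma g = 1 + p%:R * a].

Definition topological_generator (c : Gamma) : Prop :=
  Gamma1 = closure [set g : Gamma | exists n, g = (c ^+ n)%g \/ g = (c ^- n)%g].

(* The Z_p-valued function omega^j on Delta.  As omega has values in          *)
(* mu_(p-1), its powers are indexed by Z/(p-1), whose elements are read as    *)
(* natural numbers smaller than p - 1.                                        *)
Definition omega_pow (j : 'Z_p.-1) (d : Gamma) : Zp p := chi_Gamma d ^+ j.

(* t coincides with omega^k on Delta.                                         *)
Definition restricts_to_omega (t : zpchar p Gamma) (k : 'Z_p.-1) : Prop :=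
  forall d, Delta d -> t d = omega_pow k d.

(* The idempotent e_j; fset_set Delta enumerates the finite set Delta.        *)
Section Idempotents.
Variable j : 'Z_p.-1.
Implicit Types M : dmod p Gamma.

Definition idem (M : dmod p Gamma) (m : M) : M :=
  zscale (zp_inv p.-1%:R)
    (\sum_(d <- fset_set Delta) zscale (omega_pow (- j) d) (dact d m)).

Fact idemD M (m n : M) : idem (m + n) = idem m + idem n.
Proof.
rewrite /idem -zscaleD -big_split /=; congr zscale.
by apply: eq_bigr => d _; rewrite dactD zscaleD.
Qed.

Lemma idem_dfun M M' (f : dhom M M') m : f (idem m) = idem (f m).
Proof.
rewrite /idem zscale_dfun (big_morph f (dfunD f) (dfun0 f)); congr zscale.
by apply: eq_bigr => d _; rewrite zscale_dfun dfun_act.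
Qed.

Fact idem_act M g (m : M) : idem (dact g m) = dact g (idem m).
Proof.
rewrite /idem zscale_dact (big_morph _ (@dactD _ _ M g) (dact0 M g)).
congr zscale; apply: eq_bigr => d _.
by rewrite zscale_dact -!dactM Gamma_comm.
Qed.

Definition idem_hom M : dhom M M := DHom (@idemD M) (@idem_act M).

Definition eigenspace (M : dmod p Gamma) : dmod p Gamma := dimage (idem_hom M).

Definition eigenspace_cplx (X : cplx p Gamma) : cplx p Gamma.
Proof.
refine (@Cplx _ _ (fun n => eigenspace (X n))
  (fun n => image_hom (e := idem_hom (X (n - 1)))
    (e' := idem_hom (X n)) (idem_dfun (cd X n))) _ _).
  by move=> n x; apply: sgrp_eq; exact: cdd.
have [a ha] := cbounded X; exists a => n na x.
by apply: sgrp_eq; exact: ha.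
Defined.

End Idempotents.

(* The endomorphism g - c of X, after forgetting the action of Gamma.         *)
Section ActionMinusScalar.
Variables (g : Gamma) (c : Zp p).

Definition act_sub_hom (M : dmod p Gamma) : dhom (forget M) (forget M).
Proof.
apply: (@DHom _ _ (forget M) (forget M) (fun m : M => dact g m - zscale c m)).
  by move=> m n; rewrite dactD zscaleD opprD addrACA.
by [].
Defined.

Definition act_sub (X : cplx p Gamma) : cmap (forget_cplx X) (forget_cplx X).
Proof.
apply: (@CMap _ _ (forget_cplx X) (forget_cplx X) (fun n => act_sub_hom (X n))).
by move=> n x /=; rewrite dfunB dfun_act zscale_dfun.
Defined.

End ActionMinusScalar.

(* The exponent k with t = omega^k on Delta.                                  *)
Definition omega_exponent (t : zpchar p Gamma) : 'Z_p.-1 :=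
  xget 0 [set k | restricts_to_omega t k].

(* X = RGamma(H, A) is the universal cyclotomic complex in the definition of  *)
(* the cyclotomic cone C_t(A).                                                *)
Definition cyclotomic_cone (c : Gamma) (t : zpchar p Gamma) (X : cplx p Gamma) :
    cplx p trivial_group :=
  fib (act_sub c (t c) (eigenspace_cplx (omega_exponent t) X)).

End Cyclotomic.

(* Main.v *)
From HB Require Import structures.
From mathcomp Require Import all_boot all_order all_algebra all_field.
From mathcomp Require Import all_fingroup all_solvable all_character finmap.
From mathcomp Require Import all_classical topology_structure quotient_topology.
From mathcomp Require Import zify ring.
Require Import Defs.
Set Implicit Arguments.
Unset Strict Implicit.
Unset Printing Implicit Defensive.
Import Order.TTheory GRing.Theory Num.Theory.
Local Open Scope classical_set_scope.
Local Open Scope ring_scope.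

(** Twisting [J] by [theta] gives an injective resolution of [A(theta)], so that
    [RGamma(G, A(theta))] is computed by the [x] in [J] with [g x = theta^-1(g) x] for all [g].
    Since [G] is topologically generated by [H], [gamma] and the elements over [Delta], these are
    the [x] in [e_(-m) J^H] with [gamma x = theta^-1(gamma) x]. On each [e_(-m) (J^n)^H] the map
    [gamma - theta^-1(gamma)] is surjective: a preimage of [y] comes from splitting the cocycle
    [gamma^j |-> \sum_(i < j) gamma^i y] with values in the injective module [J^n(theta)]. Hence
    the kernel of this map is quasi-isomorphic to its fiber.

    That cocycle is defined on all of [G] because [gamma] has order [p^(n-1)] modulo [p^n] for
    every [n], which uses that [Q_S] contains all roots of unity of [p]-power order. The
    compactness of [G] replaces the homeomorphism of [Gamma] with [Z_p^*]. *)

(** * Complexes of injectives *)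

(** The surjectivity is in substance the vanishing of H^1 of [G] with values in an injective module;
    the obstacle is to spread partial sums indexed by powers of [gamma] to a cocycle on all of [G].
    Every [g] needs an exponent k, fixed modulo a power of [p] by the congruence chi(g)^(p-1) =
    chi(gamma)^((p-1)k) modulo a higher one: the (p-1)-st power kills the part in [Delta] and lands
    in 1 + p Z_p, where [gamma] generates, and p - 1 is invertible modulo powers of [p]. Over
    [Delta] the exponent is 0, so the cocycle vanishes there and the preimage it yields is again
    invariant over [Delta]. Compactness replaces invariance over [Delta], a condition on exact
    values of chi, by a congruence modulo some p^n. The two given resolutions are unrelated; they
    are compared by a chain map read off from a null homotopy. The equality with the cone asks in
    addition that a character determine its exponent modulo p - 1, hence for an element of [Delta]
    of order p - 1. *)

Section Hom.
Variables (p : nat) (K : topGroupType).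
Implicit Types M N Q : dmod p K.

Lemma dhom_eq M N (f g : dhom M N) : f =1 g -> f = g.
Proof.
case: f g => f fD fa [g gD ga] /= fg.
have E : f = g by apply: funext.
rewrite E in fD fa *; congr DHom; exact: Prop_irrelevance.
Qed.

Definition dcomp M N Q (g : dhom N Q) (f : dhom M N) : dhom M Q.
Proof.
apply: (@DHom _ _ M Q (fun x => g (f x))).
  by move=> x y; rewrite !dfunD.
by move=> s x; rewrite !dfun_act.
Defined.

Definition dhomB M N (f g : dhom M N) : dhom M N.
Proof.
apply: (@DHom _ _ M N (fun x => f x - g x)).
  by move=> x y; rewrite !dfunD opprD addrACA.
by move=> s x; rewrite !dfun_act dactB.
Defined.

Definition dinr M N : dhom N (dsum M N).
Proof.
apply: (@DHom _ _ N (dsum M N) (fun x => (0, x))).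
  by move=> x y; congr (_, _); rewrite addr0.
by move=> s x /=; rewrite dact0.
Defined.

Definition dinl M N : dhom M (dsum M N).
Proof.
apply: (@DHom _ _ M (dsum M N) (fun x => (x, 0))).
  by move=> x y; congr (_, _); rewrite addr0.
by move=> s x /=; rewrite dact0.
Defined.

Definition dfst M N : dhom (dsum M N) M.
Proof. by apply: (@DHom _ _ (dsum M N) M fst). Defined.

Definition dsnd M N : dhom (dsum M N) N.
Proof. by apply: (@DHom _ _ (dsum M N) N snd). Defined.

(* The image of [u], as a submodule of [N], is obtained as the image of the endomorphism
   [(m, n) |-> (0, u m)] of [M * N]. *)
Lemma dinjective_factor M N Q (u : dhom M N) (f : dhom M Q) : dinjective Q ->
  (forall x, u x = 0 -> f x = 0) -> exists g : dhom N Q, forall x, g (u x) = f x.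
Proof.
move=> injQ uf.
pose e := dcomp (dinr M N) (dcomp u (dfst M N)).
have pre (z : dimage e) : exists x, (val z).2 = u x.
  by have [[x y] ->] := sgrpP z; exists x.
have uniqf x y : u x = u y -> f x = f y.
  by move=> xy; apply/eqP; rewrite -subr_eq0 -dfunB uf // dfunB xy subrr.
pose f0 z := f (sval (cid (pre z))).
have f0E z x : (val z).2 = u x -> f0 z = f x.
  by move=> zx; rewrite /f0; case: cid => x' /= zx'; apply: uniqf; rewrite -zx -zx'.
have f0D z z' : f0 (z + z') = f0 z + f0 z'.
  have [x zx] := pre z; have [x' zx'] := pre z'.
  rewrite (f0E z x) // (f0E z' x') // -dfunD; apply: f0E.
  by rewrite dfunD -zx -zx'.
have f0a g z : f0 (dact g z) = dact g (f0 z).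
  have [x zx] := pre z; rewrite (f0E z x) // -dfun_act; apply: f0E.
  by rewrite dfun_act -zx.
have iD (z z' : dimage e) : (val (z + z')).2 = (val z).2 + (val z').2 by [].
have ia g (z : dimage e) : (val (dact g z)).2 = dact g (val z).2 by [].
have iinj : injective (DHom iD ia).
  move=> z z' /= zz'; apply: sgrp_eq.
  have fst0 (t : dimage e) : (val t).1 = 0 by have [w ->] := sgrpP t.
  by rewrite [LHS]surjective_pairing [RHS]surjective_pairing !fst0; congr (_, _).
have [g hg] := injQ _ _ _ (DHom f0D f0a) iinj.
exists g => x.
have ex : image_subgrp e (0, u x) by exists (x, 0).
by have /= -> := hg (sgrp_in ex); exact: f0E.
Qed.

End Hom.

Section Complexes.
Variables (p : nat) (K : topGroupType).
Implicit Types X Y C Q : cplx p K.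

Definition acyclic C : Prop :=
  forall n x, cd C n x = 0 -> exists y, x = cd C (n - 1) y.

(** An element of degree [n] is in the source of a differential only once [n] is written as
    [m - 1]. *)
Lemma int_pred (n : int) : exists m, n = m - 1.
Proof. by exists (n + 1); rewrite addrK. Qed.

(** Transport along k + 1 - 1 = k; proof irrelevance removes it in degrees of the form [n - 1]. *)
Lemma pred_family (P : int -> Type) (F : forall n : int, P (n - 1)) :
  exists f : forall k, P k, forall n, f (n - 1) = F n.
Proof.
exists (fun k => eq_rect _ P (F (k + 1)) k (addrK 1 k)) => n.
move: (addrK _ _); move: (n - 1 + 1) (subrK 1 n) => m -> e.
by rewrite (Prop_irrelevance e erefl).
Qed.

(** Injectivity on cohomology makes [x] a boundary; surjectivity one degree lower corrects the
    second component by a cocycle of [X]. *)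
Lemma fib_acyclic X Y (f : cmap X Y) : quasi_iso f -> acyclic (fib f).
Proof.
move=> qf n [x y] [dx fx].
have fx' : f (n - 1) x = cd Y (n - 1) y by apply/eqP; rewrite -subr_eq0 fx.
have [x' xE] := (qf n).1 x dx (ex_intro _ y fx').
have dz : cd Y (n - 1) (y - f (n - 1 - 1) x') = 0.
  by rewrite dfunB -cfun_d -xE fx' subrr.
have [x'' dx'' [y'' yE]] := (qf (n - 1)).2 _ dz.
exists (x' + x'', - y''); congr (_, _); first by rewrite dfunD dx'' addr0.
rewrite -[LHS](subrK (f (n - 1 - 1) x')) yE !dfunD [LHS]addrC [LHS]addrA.
by congr (_ + _); rewrite /= -[- y'']sub0r dfunB dfun0 sub0r opprK.
Qed.

Lemma acyclic_fib X Y (f : cmap X Y) : acyclic (fib f) -> quasi_iso f.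
Proof.
move=> af n; split.
  move=> x dx [y fxy].
  have /af[[x' y'] [-> _]] : cd (fib f) n (x, y) = 0.
    by congr (_, _); rewrite /= ?dx ?fxy ?subrr.
  by exists x'.
have [m ->] := int_pred n => y dy.
have /af[[x y'] [dx yE]] : cd (fib f) m (0, y) = 0.
  by congr (_, _); rewrite /= ?dfun0 // dy subrr.
exists x; first by rewrite -dx.
exists (- y'); rewrite yE; congr (_ + _).
by rewrite -[- y']sub0r dfunB dfun0 sub0r.
Qed.

Definition ccomp X Y Q (g : cmap Y Q) (f : cmap X Y) : cmap X Q.
Proof.
apply: (@CMap _ _ X Q (fun n => dcomp (g n) (f n))).
by move=> n x /=; rewrite !cfun_d.
Defined.

Lemma quasi_iso_comp X Y Q (g : cmap Y Q) (f : cmap X Y) :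
  quasi_iso g -> quasi_iso f -> quasi_iso (ccomp g f).
Proof.
move=> qg qf n; split.
  move=> x dx gfx; apply: (qf n).1 => //.
  by apply: (qg n).1; rewrite // -cfun_d dx dfun0.
move=> z dz; have [y dy [z' ->]] := (qg n).2 z dz.
have [x dx [y' ->]] := (qf n).2 y dy.
exists x => //; exists (g (n - 1 - 1) y' + z').
by rewrite !dfunD addrA cfun_d.
Qed.

Lemma quasi_iso_bij X Y (f : cmap X Y) :
  (forall n, injective (f n)) -> (forall n y, exists x, f n x = y) -> quasi_iso f.
Proof.
move=> inj sur n; split.
  move=> x dx [y fxy]; have [x' x'y] := sur _ y; exists x'.
  by apply: inj; rewrite fxy cfun_d x'y.
move=> y dy; have [x xy] := sur _ y; exists x.
  by apply: inj; rewrite cfun_d xy dy dfun0.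
by exists 0; rewrite xy dfun0 addr0.
Qed.

Definition cmap_id X : cmap X X.
Proof.
apply: (@CMap _ _ X X (fun n => @DHom _ _ (X n) (X n) id (fun _ _ => erefl) (fun _ _ => erefl))).
by [].
Defined.

Lemma quasi_iso_id X : quasi_iso (cmap_id X).
Proof. by apply: quasi_iso_bij => [n x y|n y] //; exists y. Qed.

Section NullHomotopy.
Variables (C Q : cplx p K) (h : cmap C Q).
Hypotheses (aC : acyclic C) (injQ : forall n, dinjective (Q n)).

Let extends (n : int) (s : dhom (C (n - 1)) (Q (n - 1 - 1))) (s' : dhom (C n) (Q (n - 1))) :=
  forall x, h (n - 1) x = cd Q (n - 1) (s x) + s' (cd C n x).

(** A total function with default 0, so that homotopies can be iterated before they are known to
    extend. *)
Let step (n : int) (s : dhom (C (n - 1)) (Q (n - 1 - 1))) : dhom (C n) (Q (n - 1)) :=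
  if pselect (exists s', extends s s') is left e then sval (cid e) else dhom0 _ _.

(* [approx k n] extends the zero homotopy in degree [n - k] by [k] steps. *)
Let approx : nat -> forall n : int, dhom (C n) (Q (n - 1)) :=
  fix approx k n := if k is k'.+1 then step (approx k' (n - 1)) else dhom0 _ _.

Lemma null_homotopic :
  exists s : forall n, dhom (C n) (Q (n - 1)), forall n x,
    h (n - 1) x = cd Q (n - 1) (s (n - 1) x) + s n (cd C n x).
Proof.
have [a ha] := cbounded C.
have zero n (s s' : dhom (C n) (Q (n - 1))) : n < a -> s = s'.
  by move=> na; apply: dhom_eq => x; rewrite (ha n na x) !dfun0.
have stable k : forall l n, n < a + k%:Z -> n < a + l%:Z -> approx k n = approx l n.
  elim: k => [|k IH] [|l] n hk hl; try by apply: zero; rewrite ?(addr0 a) in hk hl.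
  by rewrite /=; congr step; apply: IH; rewrite ltrBlDr -addrA -PoszD addn1.
(* Enough steps to start below the bound [a], where all maps out of [C] agree. *)
pose N n := (`|n - a|%N).+1.
have NP n : n < a + (N n)%:Z.
  by rewrite -ltrBlDl /N intS ltz1D abszE ler_norm.
pose s n := approx (N n) n.
have sS n : s n = step (s (n - 1)).
  rewrite /s -[RHS]/(approx (N (n - 1)).+1 n); apply: stable => //.
  by have := NP (n - 1); rewrite ltrBlDr intS -(addrA a) [1 + _]addrC.
exists s.
have base n : n < a -> extends (s (n - 1)) (s n).
  move=> na x; have -> : x = 0 by apply: ha; apply: lt_trans na; rewrite gtrBl.
  by rewrite !dfun0 addr0.
have ind n : extends (s (n - 1 - 1)) (s (n - 1)) -> extends (s (n - 1)) (s n).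
  move=> en; rewrite (sS n) /step.
  suff [s' hs'] : exists s', extends (s (n - 1)) s'.
    by case: pselect => [e|ne]; [case: cid|case: ne; exists s'].
  (* By acyclicity the kernel of [cd C n] consists of boundaries, and [f] kills these, so [f]
     factors through [cd C n]. *)
  pose f := dhomB (h (n - 1)) (dcomp (cd Q (n - 1)) (s (n - 1))).
  have [||s' hs'] := @dinjective_factor _ _ _ _ _ (cd C n) f; first exact: injQ.
    move=> x /aC[y ->] /=; rewrite cfun_d en dfunD cdd add0r.
    by rewrite subrr.
  by exists s' => x; rewrite hs' /= addrCA subrr addr0.
have main k : forall n, n < a + k%:Z -> extends (s (n - 1)) (s n).
  elim: k => [|k IH] n; first by rewrite addr0; exact: base.
  by move=> nk; apply/ind/IH; rewrite ltrBlDr -addrA -PoszD addn1.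
by move=> n; exact: (main (N n)).
Qed.

End NullHomotopy.

(** Two out of three, for a triangle that commutes up to the homotopy [s]. *)
Lemma quasi_iso_homotopic X Y Q (i : cmap X Y) (g : cmap X Q) (f : cmap Y Q)
    (s : forall n, dhom (X n) (Q (n - 1))) :
  (forall n x, g (n - 1) x =
     f (n - 1) (i (n - 1) x) + cd Q (n - 1) (s (n - 1) x) + s n (cd X n x)) ->
  quasi_iso i -> quasi_iso g -> quasi_iso f.
Proof.
move=> sE qi qg n; split.
  move=> y dy [z fyz]; have [x dx [y' yE]] := (qi n).2 y dy.
  have [x' xE] : exists x', x = cd X (n - 1) x'.
    apply: (qg n).1 => //; exists (z - f (n - 1 - 1) y' + s (n - 1) x).
    rewrite sE dx dfun0 addr0 dfunD dfunB -fyz yE dfunD cfun_d.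
    by rewrite addrK.
  by exists (i (n - 1 - 1) x' + y'); rewrite dfunD -cfun_d -xE.
move=> z dz; have [x dx [z' zE]] := (qg n).2 z dz.
exists (i (n - 1) x); first by rewrite -cfun_d dx dfun0.
exists (s (n - 1) x + z').
by rewrite zE sE dx dfun0 addr0 dfunD addrA.
Qed.

(* A map from the acyclic complex [fib i] to [Q] is null homotopic, and the component of the
   homotopy on [Y] is a chain map that extends [g] up to homotopy. *)
Lemma extend_quasi_iso X Y Q (i : cmap X Y) (g : cmap X Q) :
  quasi_iso i -> quasi_iso g -> (forall n, dinjective (Q n)) ->
  exists f : cmap Y Q, quasi_iso f.
Proof.
move=> qi qg injQ.
have hd n x : dcomp (g n) (dfst (X n) (Y (n - 1))) (cd (fib i) n x) =
    cd Q n (dcomp (g (n - 1)) (dfst (X (n - 1)) (Y (n - 1 - 1))) x).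
  by rewrite /= cfun_d.
have [s sE] := null_homotopic (CMap hd) (fib_acyclic qi) injQ.
have [f fE] := @pred_family (fun k => dhom (Y k) (Q k))
  (fun n => dcomp (s n) (dinr (X n) (Y (n - 1)))).
have fd n x : f n (cd Y n x) = cd Q n (f (n - 1) x).
  have [m mn] := int_pred n; rewrite mn in x *; rewrite !fE.
  have /eqP := sE m (0, - x); rewrite /= !dfun0 sub0r.
  have -> : - cd Y (m - 1) (- x) = cd Y (m - 1) x.
    by rewrite -[- x]sub0r dfunB dfun0 sub0r opprK.
  have -> : (0, - x) = 0 - dinr (X (m - 1)) (Y (m - 1 - 1)) x.
    by congr (_, _); rewrite /= ?subrr ?sub0r.
  rewrite [s (m - 1) _]dfunB dfun0 sub0r -[- s _ _]sub0r dfunB dfun0 sub0r.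
  by rewrite eq_sym [X in X == 0]addrC subr_eq0 => /eqP.
exists (CMap fd).
apply: (@quasi_iso_homotopic _ _ _ i g _ (fun n => dcomp (s n) (dinl (X n) (Y (n - 1))))) => //.
move=> n x; have := sE n (x, 0); rewrite /= fE /= dfun0 subr0 => ->.
rewrite [RHS]addrAC [RHS]addrC; congr (_ + _).
by rewrite -[RHS]dfunD; congr (s n _); congr (_, _); rewrite ?add0r ?addr0.
Qed.

(** As [g] is onto, subtracting the boundary of some [(w, 0)] clears the second component of an
    element of the fiber; for a cocycle, the first component then lies in the kernel. *)
Lemma kernel_quasi_iso X Y Q (k : cmap X Y) (g : cmap Y Q) (kf : cmap X (fib g)) :
  (forall n x, kf n x = (k n x, 0)) ->
  (forall n, injective (k n)) ->
  (forall n y, g n y = 0 -> exists x, k n x = y) ->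
  (forall n z, exists y, g n y = z) ->
  quasi_iso kf.
Proof.
move=> kfE inj ker sur n; split.
  move=> x dx [[y z]]; rewrite kfE => -[kx /eqP]; rewrite eq_sym subr_eq0 => /eqP gy.
  have [w wz] := sur _ z.
  have [|x' x'E] := ker (n - 1 - 1) (y - cd Y (n - 1 - 1) w).
    by rewrite dfunB cfun_d wz gy subrr.
  exists x'; apply: inj; rewrite cfun_d x'E dfunB cdd subr0.
  exact: kx.
move=> [y z] [dy /eqP]; rewrite subr_eq0 => /eqP gy.
have [w wz] := sur _ z.
have [|x xE] := ker (n - 1) (y - cd Y (n - 1) w).
  by rewrite dfunB cfun_d wz gy subrr.
exists x.
  by apply: inj; rewrite cfun_d xE dfunB cdd subr0 dfun0.
exists (w, 0); rewrite kfE; congr (_, _) => /=.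
  by rewrite xE subrK.
by rewrite dfun0 subr0 add0r wz.
Qed.

End Complexes.

Section InvariantsOfInjectives.
Variables (p : nat) (K : topGroupType).

Lemma dsum_injective (M N : dmod p K) :
  dinjective M -> dinjective N -> dinjective (dsum M N).
Proof.
move=> iM iN P Q i f inj.
have [g gE] := iM P Q i (dcomp (dfst M N) f) inj.
have [h hE] := iN P Q i (dcomp (dsnd M N) f) inj.
have D x y : (g (x + y), h (x + y)) = (g x, h x) + (g y, h y) :> dsum M N.
  by rewrite !dfunD.
have a s x : (g (dact s x), h (dact s x)) = dact s ((g x, h x) : dsum M N).
  by rewrite !dfun_act.
by exists (DHom D a) => x /=; rewrite gE hE /= -surjective_pairing.
Qed.

Variable N : normal_subgroup K.

Definition inv_cmap (X Y : cplx p K) (f : cmap X Y) :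
  cmap (invariants_cplx N X) (invariants_cplx N Y).
Proof.
apply: (@CMap _ _ (invariants_cplx N X) (invariants_cplx N Y)
  (fun n => inv_hom N (f n))).
by move=> n x; apply: sgrp_eq; exact: cfun_d.
Defined.

(* The fiber of [f] is contractible, and invariants preserve contractions. *)
Lemma inv_quasi_iso (X Y : cplx p K) (f : cmap X Y) :
  (forall n, dinjective (X n)) -> (forall n, dinjective (Y n)) ->
  quasi_iso f -> quasi_iso (inv_cmap f).
Proof.
move=> iX iY /fib_acyclic af.
have iF n : dinjective (fib f n) by apply: dsum_injective; [exact: iX|exact: iY].
have [s sE] := null_homotopic (cmap_id (fib f)) af iF.
apply: acyclic_fib => n [x y] dxy.
have dxy' : cd (fib f) n (val x, val y) = 0.
  by case: dxy => dx dy; congr (_, _); [exact: dx|exact: dy].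
have := sE n (val x, val y); rewrite dxy' dfun0 addr0 /=.
case sxy : (s (n - 1) (val x, val y)) => [x' y'] [xE yE].
have sinv h : N h -> dact h x' = x' /\ dact h y' = y'.
  move=> Nh; have := dfun_act (s (n - 1)) h (val x, val y).
  by rewrite /= (sgrpP x) // (sgrpP y) // sxy => -[<- <-].
have hx : inv_subgrp N (X (n - 1 - 1)) x' by move=> h /sinv[].
have hy : inv_subgrp N (Y (n - 1 - 1 - 1)) y' by move=> h /sinv[].
by exists (sgrp_in hx, sgrp_in hy); congr (_, _); apply: sgrp_eq.
Qed.

Definition forget_cmap (X Y : cplx p K) (f : cmap X Y) :
  cmap (forget_cplx X) (forget_cplx Y).
Proof.
apply: (@CMap _ _ (forget_cplx X) (forget_cplx Y) (fun n => forget_hom (f n))).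
by move=> n x; exact: (@cfun_d _ _ _ _ f n x).
Defined.

Lemma forget_quasi_iso (X Y : cplx p K) (f : cmap X Y) :
  quasi_iso f -> quasi_iso (forget_cmap f).
Proof. by []. Qed.

End InvariantsOfInjectives.

(** On each element [zscale a] is multiplication by an integer. The two groups may differ, and so
    may the twists, so this also moves scalars across maps that are not equivariant. *)
Lemma zscale_additive (p : nat) (K K' : topGroupType) (M : dmod p K) (P : dmod p K')
    (f : M -> P) a x :
  (forall x y, f (x + y) = f x + f y) -> f (zscale a x) = zscale a (f x).
Proof.
move=> fD.
have f0 : f 0 = 0 by apply: (addrI (f 0)); rewrite -fD !addr0.
have fMn y k : f (y *+ k) = f y *+ k.
  by elim: k => [|k IH]; rewrite ?mulr0n // !mulrS fD IH.
have fN y : f (- y) = - f y.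
  by apply: (addrI (f y)); rewrite -fD !subrr.
have [k xk] := dmod_primary x.
rewrite (zscaleE _ xk) (@zscaleE _ _ _ _ _ k) -?fMn ?xk //.
by case: (zres a k) => l; rewrite ?NegzE ?mulrNz -!pmulrn ?fN fMn.
Qed.

(** * Twists, and cocycles with values in injective modules *)

Section Twists.
Variables (p : nat) (K : topGroupType) (N : normal_subgroup K).
Variables (t : zpchar p (quotient_group N)).

Lemma twist_actE (M : dmod p K) g (x : M) :
  dact g (x : twist t M) = zscale (t (qproj N g)) (dact g x).
Proof. by []. Qed.

Definition twist_hom (M P : dmod p K) (f : dhom M P) :
  dhom (twist t M) (twist t P).
Proof.
apply: (@DHom _ _ (twist t M) (twist t P) f); first exact: (dfunD f).
by move=> g x /=; rewrite zscale_dfun dfun_act.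
Defined.

Definition twist_cplx (X : cplx p K) : cplx p K.
Proof.
refine (@Cplx _ _ (fun n => twist t (X n)) (fun n => twist_hom (cd X n)) _ _).
  by move=> n x; exact: cdd.
have [a ha] := cbounded X; exists a => n na x; exact: ha.
Defined.

Definition twist_cmap (X Y : cplx p K) (f : cmap X Y) :
  cmap (twist_cplx X) (twist_cplx Y).
Proof.
apply: (@CMap _ _ (twist_cplx X) (twist_cplx Y) (fun n => twist_hom (f n))).
by move=> n x; exact: (@cfun_d _ _ _ _ f n x).
Defined.

Lemma twist_quasi_iso (X Y : cplx p K) (f : cmap X Y) :
  quasi_iso f -> quasi_iso (twist_cmap f).
Proof. by []. Qed.

Lemma zscale_inv_char (M : dmod p K) q (x : M) :
  zscale (zchar_inv t q) (zscale (t q) x) = x.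
Proof. by rewrite -zscaleA /= zcharV -zcharM mulVg zchar1 zscale1. Qed.

Lemma zscale_char_inv (M : dmod p K) q (x : M) :
  zscale (t q) (zscale (zchar_inv t q) x) = x.
Proof. by rewrite -zscaleA /= zcharV -zcharM mulgV zchar1 zscale1. Qed.

(** The degree must be matched before the modules can be compared: outside degree 0 one is [dzero]
    and the other a twist of [dzero]. *)
Definition single_twist_map (A : dmod p K) :
  cmap (single (twist t A)) (twist_cplx (single A)).
Proof.
refine (@CMap _ _ (single (twist t A)) (twist_cplx (single A))
  (fun n => match n as m return
     dhom (single (twist t A) m) (twist_cplx (single A) m) with
   | Posz 0 => @DHom _ _ (twist t A) (twist t A) id (fun _ _ => erefl) (fun _ _ => erefl)
   | _ => dhom0 _ _ end) _).
by move=> n x; rewrite /= -[RHS]/(0) dfun0.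
Defined.

Lemma single_twist_quasi_iso A : quasi_iso (single_twist_map A).
Proof.
apply: quasi_iso_bij => [n|n y].
  by case: n => [[|n]|n] // x y _; rewrite (ord1 (x : 'I_1)) (ord1 (y : 'I_1)).
case: n y => [[|n]|n] y; first by exists y.
- by exists 0; rewrite dfun0 (ord1 (y : 'I_1)).
- by exists 0; rewrite dfun0 (ord1 (y : 'I_1)).
Qed.

End Twists.

(** Twisting is invertible: an extension problem from [M] into [twist t I] is one from [twist t' M]
    into [I]. *)
Lemma twist_injective (p : nat) (K : topGroupType) (N : normal_subgroup K)
    (t : zpchar p (quotient_group N)) (I : dmod p K) :
  dinjective I -> dinjective (twist t I).
Proof.
move=> injI M P i f inj.
pose t' := zchar_inv t.
have fact g (x : twist t' M) : f (dact g x) = dact g (f x : I) :> I.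
  rewrite twist_actE (zscale_dfun f) dfun_act twist_actE.
  rewrite (@zscale_additive _ _ _ (twist t I) I id) //.
  exact: zscale_inv_char.
have [g gE] := injI _ _ (twist_hom t' i)
  (@DHom _ _ (twist t' M) I f (dfunD f) fact) inj.
have gact s (x : P) : g (dact s x) = dact s (g x : twist t I).
  rewrite twist_actE -dfun_act twist_actE.
  rewrite -(@zscale_additive _ _ _ (twist t' P) I g) //; last exact: dfunD.
  rewrite (@zscale_additive _ _ _ (twist t' P) P id) //.
  by rewrite zscale_char_inv.
by exists (@DHom _ _ P (twist t I) g (dfunD g) gact).
Qed.

(* The cocycle defines an extension of [Z/p^(k+1)] by [I], which splits since [I] is injective. *)
Lemma injective_cocycle (p : nat) (K : topGroupType) (I : dmod p K) (c : K -> I) k :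
  prime p -> dinjective I ->
  (forall g h, c (g * h)%g = c g + dact g (c h)) ->
  (forall g, \forall h \near g, c h = c g) ->
  (forall g, c g *+ p ^ k.+1 = 0) ->
  exists x, forall g, c g = dact g x - x.
Proof.
move=> pp injI cM cc ck.
(* The exponent [k.+1] ensures 1 < q, so that this ordinal type really is Z/q. *)
pose q := (p ^ k.+1)%N; pose C : zmodType := 'I_((Zp_trunc q).+2).
have q1 : (1 < q)%N by rewrite -(exp1n k.+1) ltn_exp2r // prime_gt1.
have qE : (Zp_trunc q).+2 = q by exact: Zp_cast.
have modE n : (n %% (Zp_trunc q).+2 = n %% q)%N by rewrite qE.
have cD g (a b : C) : c g *+ (a + b)%R = c g *+ a + c g *+ b.
  have -> : (a + b)%R = ((a + b)%N %% q)%N :> nat by exact: modE.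
  by rewrite -mulrnDr [in RHS](divn_eq (a + b) q) mulrnDr mulnC mulrnA ck mul0rn add0r.
have c1 : c 1%g = 0.
  by have := cM 1%g 1%g; rewrite mulg1 dact1 -[LHS]addr0 => /addrI.
have valMn (u : I * C) n : u *+ n = (u.1 *+ n, u.2 *+ n).
  by case: u => x y; elim: n => // n IH; rewrite !mulrS IH.
pose act g (u : I * C) : I * C := (dact g u.1 + c g *+ u.2, u.2).
have a1 m : act 1%g m = m by rewrite /act dact1 c1 mul0rn addr0 -surjective_pairing.
have aM s h m : act (s * h)%g m = act s (act h m).
  rewrite /act /= dactM dactD -addrA dactMn; congr (_ + _, _).
  by rewrite cM mulrnDl addrC.
have aD s m n : act s (m + n) = act s m + act s n.
  by congr (_, _); rewrite dactD [(m + n).2]/= cD addrACA.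
have ac m s : \forall h \near s, act h m = act s m.
  by apply: filterS2 (cc s) (dmod_cont m.1 s) => h ch mh; rewrite /act ch mh.
have ap (m : I * C) : exists n, m *+ p ^ n = 0.
  have [n mn] := dmod_primary m.1; exists (n + k.+1)%N.
  rewrite valMn expnD mulrnA mn mul0rn mulnC mulrnA; congr (_, _).
  suff -> : m.2 *+ p ^ k.+1 = 0 by rewrite mul0rn.
  by apply: val_inj; rewrite Zp_mulrn /= modE modnMl.
pose E := @DMod p K (I * C)%type act a1 aM aD ac ap.
have iD (x y : I) : ((x + y, 0) : E) = (x, 0) + (y, 0) by congr (_, _); rewrite addr0.
have ia g (x : I) : (dact g x, 0) = dact g ((x, 0) : E).
  by congr (_, _); rewrite addr0.
have inj : injective (DHom iD ia) by move=> x y [].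
have [r rE] := injI _ _ (DHom iD ia)
  (@DHom _ _ I I id (fun _ _ => erefl) (fun _ _ => erefl)) inj.
(* In the extension, g (0, 1) - (0, 1) = (c g, 0), and the retraction [r] carries this to the wanted
   identity. *)
exists (r (0, 1)) => g; rewrite -dfun_act -dfunB.
have -> : dact g ((0, 1) : E) - (0, 1) = DHom iD ia (c g).
  by congr (_, _); rewrite /= ?subrr // dact0 add0r subr0 modn_small // mulr1n.
by rewrite rE.
Qed.

(** * Roots of unity in [Q_S] *)

Section FrobeniusModPrime.
Variables (l : nat) (l_prime : prime l).

Lemma eqAmodX e n : {in Aint &, forall x y, x == y %[mod e] -> x ^+ n == y ^+ n %[mod e]}%A.
Proof.
move=> x y Zx Zy xy; elim: n => [|n IH]; first by rewrite !expr0.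
by rewrite !exprS; apply: eqAmodM => //; exact: rpredX.
Qed.

Lemma eqAmod_frobD :
  {in Aint &, forall x y, (x + y) ^+ l == x ^+ l + y ^+ l %[mod l%:R]}%A.
Proof.
move=> x y Zx Zy.
case: l l_prime => // m pm; set n := m.+1 in pm *.
rewrite exprDn big_ord_recl big_ord_recr /= subn0 bin0 subnn binn.
rewrite !expr0 !mulr1 !mul1r !mulr1n addrA eqAmodDr addrC.
rewrite -[X in (_ == X %[mod _])%A]add0r eqAmodDr eqAmod0 rpred_sum // => i _.
have /dvdnP[k ->] : (n %| 'C(n, bump 0 i))%N.
  by apply: prime_dvd_bin => //; rewrite /bump /= add1n ltnS ltn_ord.
rewrite -eqAmod0 mulrnA -[X in (X == _ %[mod _])%A]mulr_natr.
by apply: eqAmodMl0; rewrite rpredMn // rpredM // rpredX.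
Qed.

Lemma eqAmod_frobXD f : {in Aint &, forall x y,
  (x + y) ^+ (l ^ f) == x ^+ (l ^ f) + y ^+ (l ^ f) %[mod l%:R]}%A.
Proof.
move=> x y Zx Zy; elim: f => [|f IH]; first by rewrite !expr1.
rewrite expnSr !exprM.
apply: eqAmod_trans (eqAmodX l _ _ IH) _; rewrite ?rpredD ?rpredX ?rpredD //.
by apply: eqAmod_frobD; rewrite rpredX.
Qed.

(** Congruence is modulo [l] in the ring of all algebraic integers. The power map is additive there
    modulo [l], so this is a subring and membership can be tested on generators. *)
Definition frob_fixed f : {pred algC} :=
  fun x => (x \in Aint) && (x ^+ (l ^ f) == x %[mod l%:R])%A.

Fact frob_fixed_subring f : subring_closed (frob_fixed f).
Proof.
have D x y : x \in frob_fixed f -> y \in frob_fixed f -> x + y \in frob_fixed f.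
  move=> /andP[Zx hx] /andP[Zy hy]; rewrite unfold_in rpredD //=.
  by apply: eqAmod_trans (eqAmod_frobXD f Zx Zy) _; exact: eqAmodD.
split.
- by rewrite unfold_in Aint1 expr1n /=.
- move=> x y hx /andP[Zy hy]; apply: D => //; rewrite unfold_in rpredN Zy /=.
  have := eqAmod_frobXD f Zy (etrans (rpredN _ y) Zy); rewrite subrr expr0n.
  rewrite expn_eq0 eqn0Ngt prime_gt0 //= eqAmod_sym => h.
  rewrite -(eqAmodDl _ y) subrr; apply: eqAmod_trans h.
  by rewrite eqAmodDr eqAmod_sym.
- move=> x y /andP[Zx hx] /andP[Zy hy]; rewrite unfold_in rpredM //= exprMn.
  by apply: eqAmodM => //; exact: rpredX.
Qed.
HB.instance Definition _ f :=
  GRing.isSubringClosed.Build algC (frob_fixed f) (frob_fixed_subring f).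

(** The integer [n] is itself fixed modulo [l], so n (x^(l^f) - x) vanishes modulo [l], where [n] is
    invertible. *)
Lemma frob_fixed_cancel f (n : nat) x : x \in Aint -> coprime n l ->
  n%:R * x \in frob_fixed f -> x \in frob_fixed f.
Proof.
move=> Zx; have [-> | n0] := posnP n.
  by rewrite /coprime gcd0n => /eqP l1; have := prime_gt1 l_prime; rewrite l1.
case/coprimeP => // -[u v] /= uv nx; rewrite unfold_in Zx /=.
have : (n%:R * (x ^+ (l ^ f) - x) == 0 %[mod l%:R])%A.
  have nf : n%:R \in frob_fixed f by exact: rpred_nat.
  move: nx; rewrite unfold_in exprMn => /andP[_ hnx].
  rewrite mulrBr /eqAmod subr0 -/(eqAmod _ _ _); apply: eqAmod_trans hnx.
  by rewrite eqAmod_sym; apply: eqAmodMr; [exact: rpredX|case/andP: nf].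
have Znat k : k%:R \in Aint by exact: rpred_nat.
move=> /(eqAmodMl (Znat u)); rewrite mulr0 mulrA -natrM.
have -> : (u * n = 1 + v * l)%N by rewrite -uv subnK // ltnW // -subn_gt0 uv.
rewrite natrD mulrDl mul1r => h.
rewrite /eqAmod -eqAmod0; apply: eqAmod_trans h; rewrite eqAmod_sym.
rewrite -[X in (_ == X %[mod _])%A]addr0 eqAmodDl natrM mulrAC.
by apply: eqAmodMl0; rewrite rpredM ?rpredB ?rpredX ?Znat.
Qed.

End FrobeniusModPrime.

Lemma ring_of_integers_Aint (F : fieldExtType rat) (i : {rmorphism F -> algC}) x :
  @ring_of_integers F x <-> i x \in Aint.
Proof.
have comp (q : {poly int}) : map_poly i (map_poly intr q) = map_poly intr q.
  by rewrite -map_poly_comp; apply: eq_map_poly => c; rewrite /= rmorph_int.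
split=> [[q mq qx]|ix].
  apply: (@root_monic_Aint (map_poly intr q)).
  - by rewrite -comp fmorph_root.
  - by rewrite monic_map.
  - by apply/polyOverP => k; rewrite coef_map /= intr_int.
have /floorpP[q qE] := ix; exists q.
  move: (minCpoly_monic (i x)); rewrite qE !monicE lead_coef_map_inj ?rmorph0 //.
    by rewrite -[1]/(1%:~R) eqr_int.
  exact: intr_inj.
by rewrite -(fmorph_root i) comp -qE root_minCpoly.
Qed.

(* [a^q = a] modulo [l] makes [1 - a^(q-1)] kill [a] modulo [l]; if [l] were a combination of
   products of elements of [P], multiplying it by the square of a product of such factors would
   put that product in [P]. *)
Lemma frobenius_unramified (F : fieldExtType rat) (i : {rmorphism F -> algC}) l q :
  prime l -> (1 < q)%N ->
  (forall x, i x \in Aint -> exists2 z, i z \in Aint & x ^+ q = x + l%:R * z) ->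
  unramified_at F l.
Proof.
move=> pl q1 frob P [[PO P0 PD PM] P1 Pprime] Pl.
have OA := ring_of_integers_Aint i.
have O_X x n : @ring_of_integers F x -> @ring_of_integers F (x ^+ n).
  by move=> /OA h; apply/OA; rewrite rmorphXn rpredX.
have OM x y : @ring_of_integers F x -> @ring_of_integers F y -> @ring_of_integers F (x * y).
  by move=> /OA h /OA h'; apply/OA; rewrite rmorphM rpredM.
have OB x y : @ring_of_integers F x -> @ring_of_integers F y -> @ring_of_integers F (x - y).
  by move=> /OA h /OA h'; apply/OA; rewrite rmorphB rpredB.
have O1 : @ring_of_integers F 1 by apply/OA; rewrite rmorph1 Aint1.
have O0 : @ring_of_integers F 0 by apply/OA; rewrite rmorph0 Aint0.
have OD x y : @ring_of_integers F x -> @ring_of_integers F y -> @ring_of_integers F (x + y).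
  by move=> /OA h /OA h'; apply/OA; rewrite rmorphD rpredD.
have l0 : l%:R != 0 :> F by rewrite -(fmorph_eq0 i) rmorph_nat pnatr_eq0 -lt0n prime_gt0.
split.
  by exists 1%N, (fun=> l%:R), (fun=> 1); split=> //; rewrite big_ord1 mulr1.
case=> n [a [b [Pab lE]]].
have Pa j : P (a j) by have [] := Pab j.
have Pb j : P (b j).
  have [_ [k [a' [b' [h ->]]]]] := Pab j.
  apply: big_ind => // t _; have [Pa' Ob'] := h t.
  by rewrite mulrC; exact: PM.
pose e x : F := 1 - x ^+ q.-1.
have eO x : P x -> @ring_of_integers F (e x) by move=> Px; apply: OB => //; apply: O_X; exact: PO.
have eP x : P x -> ~ P (e x).
  move=> Px Pe; apply: P1; rewrite -(subrK (x ^+ q.-1) 1); apply: PD => //.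
  have -> : q.-1 = q.-2.+1 by case: (q) q1 => [|[]].
  by rewrite exprSr; apply: PM => //; apply: O_X; exact: PO.
have ex x : P x -> exists2 z, @ring_of_integers F z & x * e x = l%:R * z.
  move=> Px; have [|z Oz xE] := frob x; first exact/OA/PO.
  exists (- z); first by apply/OA; rewrite rmorphN rpredN.
  rewrite mulrBr mulr1 -exprS prednK ?(ltnW q1) // xE opprD addrA subrr sub0r.
  by rewrite mulrN.
pose f := \prod_(j < n) (e (a j) * e (b j)).
have fO : @ring_of_integers F f.
  by apply: big_ind => // j _; apply: OM; apply: eO.
have fP : ~ P f.
  suff [] : @ring_of_integers F f /\ ~ P f by [].
  apply: (big_ind (fun x => @ring_of_integers F x /\ ~ P x)) => //.
    move=> x y [Ox Px] [Oy Py]; split; first exact: OM.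
    by case/(Pprime _ _ Ox Oy).
  move=> j _; split; first by apply: OM; apply: eO.
  by case/Pprime; do ?exact: eO; apply: eP.
have fx x j : (x = a j \/ x = b j) -> exists2 z, @ring_of_integers F z & x * f = l%:R * z.
  move=> hx; rewrite /f (bigD1 j) //=; set g := \prod_(_ | _) _.
  have gO : @ring_of_integers F g.
    by apply: big_ind => // k _; apply: OM; apply: eO.
  case: hx => ->; [have [z Oz zE] := ex _ (Pa j)|have [z Oz zE] := ex _ (Pb j)].
    exists (z * e (b j) * g); first by apply: (OM _ _ _ gO); apply: OM => //; apply: eO.
    by rewrite !mulrA zE.
  exists (z * e (a j) * g); first by apply: (OM _ _ _ gO); apply: OM => //; apply: eO.
  by rewrite [e _ * e _]mulrC !mulrA zE.
have term j : exists z, @ring_of_integers F z /\ a j * b j * f * f = l%:R * (l%:R * z).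
  have [z Oz zE] := fx (a j) j (or_introl erefl).
  have [z' Oz' zE'] := fx (b j) j (or_intror erefl).
  exists (z * z'); split; first exact: OM.
  by rewrite [RHS]mulrA [RHS]mulrACA -zE -zE' -[LHS]mulrA mulrACA.
pose z j := sval (cid (term j)).
have zP j : @ring_of_integers F (z j) /\ a j * b j * f * f = l%:R * (l%:R * z j).
  exact: svalP (cid (term j)).
(* Each product in the expansion of [l] absorbs one [f] per factor and yields two factors [l];
   cancelling one puts f^2 in the ideal generated by [l]. *)
have : l%:R * (f * f) = l%:R * (l%:R * \sum_(j < n) z j).
  rewrite [in LHS]lE mulrA !mulr_suml !mulr_sumr; apply: eq_bigr => j _.
  by have [_ ->] := zP j.
move=> /(mulfI l0) ff; suff /(Pprime _ _ fO fO)[] : P (f * f) by [].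
rewrite ff mulrC; apply: PM => //.
by apply: big_ind => // j _; have [] := zP j.
Qed.

Section CyclotomicField.
Variables (p n : nat) (p_prime : prime p).

(* Since [\sum_i Tr(x w^-i) w^i = m x] for [m = p^n], the ring of integers is, up to [p],
   generated by [w], on which a power of the [l]-Frobenius is trivial modulo [l]. *)
Lemma cyclotomic_unramified : exists (F : fieldExtType rat) (i : {rmorphism F -> algC}) (w : F),
  (p ^ n)%N.-primitive_root w /\ unramified_outside F p.
Proof.
pose m := (p ^ n)%N.
have m0 : (0 < m)%N by rewrite expn_gt0 prime_gt0.
(* The group enters only through its order: the field obtained is generated by a primitive [m]-th
   root of unity. *)
have card : #|[set: 'I_m.-1.+1]%G| = m by rewrite cardsT card_ord prednK.
have [F galF [i nu [w [wm genw] _]]] := group_num_field_exists [set: 'I_m.-1.+1]%G.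
rewrite card in wm.
exists F, i, w; split=> // l pl lp.
have lm : coprime l m by rewrite coprimeXr // prime_coprime // dvdn_prime2 //; apply/eqP.
pose f := totient m.
have f0 : (0 < f)%N by rewrite totient_gt0.
have lf : l ^ f = 1 %[mod m] by exact: Euler_exp_totient.
have w0 : w != 0.
  apply: contra_eq_neq (prim_expr_order wm) => /= ->.
  by rewrite expr0n eqn0Ngt m0 eq_sym oner_eq0.
have iw : i w \in Aint.
  by apply: (@Aint_prim_root m); rewrite fmorph_primitive_root.
have wV k : w ^- k \in [pred x | i x \in Aint].
  rewrite inE -exprVn rmorphXn rpredX //.
  have -> : w^-1 = w ^+ m.-1.
    by apply: (mulfI w0); rewrite -exprS prednK // (prim_expr_order wm) mulfV.
  by rewrite rmorphXn rpredX.
have fixw : i w \in frob_fixed l f.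
  rewrite unfold_in iw -rmorphXn -(prim_expr_mod wm) lf (prim_expr_mod wm) expr1.
  exact: eqAmod_refl.
pose Tr (x : F) : F := galTrace 1 {:F} x.
have TrA x : i x \in Aint -> i (Tr x) \in Num.int.
  move=> ix; have : Tr x \in 1%VS by apply: mem_galTrace => //; exact: memvf.
  case/vlineP => c cE; apply: Cint_rat_Aint.
    by rewrite cE rmorphZ_num rmorph1 mulr1 Crat_rat.
  rewrite rmorph_sum rpred_sum // => s _.
  by have [u ->] := nu s; rewrite Aint_aut.
(* The variable [E] lets the dependent type [gal_of] follow the equality of the full field with the
   one generated by [w]. *)
have genA (s : gal_of {:F}) : s \in galoisG {:F} 1 -> (s == 1%g) = (s w == w).
  suff gen (E : {subfield F}) : E = <<1; w>>%AS -> forall t : gal_of E,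
      t \in galoisG E 1 -> (t == 1%g) = (t w == w).
    by apply: gen; apply: val_inj.
  by move=> -> t tG; rewrite (gal_adjoin_eq tG) ?group1 // gal_id.
(* After exchanging sums, [s] contributes s(x) times the geometric sum of the powers of w / s(w), an
   [m]-th root of unity: [m] for s = 1 and 0 otherwise. *)
have expand x : m%:R * x = \sum_(k < m) Tr (x * w ^- k) * w ^+ k.
  rewrite /Tr /galTrace; under eq_bigr => k _ do rewrite mulr_suml.
  rewrite exchange_big /= (bigD1 1%g) ?group1 //= [X in _ + X]big1 => [|s /andP[sG s1]].
    rewrite addr0; under eq_bigr => k _.
      rewrite gal_id mulfVK ?expf_neq0 ?w0 //.
    over.
    by rewrite sumr_const card_ord mulr_natl.
  under eq_bigr => k _.
    rewrite rmorphM rmorphV ?unitfE ?expf_neq0 ?w0 // rmorphXn /=.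
    rewrite -mulrA -exprVn -exprMn.
  over.
  rewrite -mulr_sumr.
  have sw : s w != w.
    apply: contra s1 => /eqP sw.
    by rewrite genA // sw.
  pose v := (s w)^-1 * w; have v1 : v != 1.
    apply: contra sw => /eqP v1; rewrite eq_sym; apply/eqP.
    have sw0 : s w != 0 by rewrite fmorph_eq0 w0.
    by rewrite -[LHS](mulVKf sw0) -/v v1 mulr1.
  have vm : v ^+ m = 1.
    rewrite exprMn exprVn -rmorphXn (prim_expr_order wm) rmorph1 invr1 mulr1 //.
  have /eqP := subrX1 v m; rewrite vm subrr eq_sym mulf_eq0 subr_eq0 (negPf v1) /=.
  by move=> /eqP ->; rewrite mulr0.
apply: (@frobenius_unramified F i l (l ^ f)) => //.
  by rewrite -(exp1n f) ltn_exp2r // prime_gt1.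
move=> x ix.
have : i x \in frob_fixed l f.
  apply: (@frob_fixed_cancel _ pl f m) => //; first by rewrite coprime_sym.
  rewrite -(rmorph_nat i) -rmorphM expand rmorph_sum rpred_sum // => k _.
  rewrite rmorphM rmorphXn rpredM ?rpredX //.
  have /TrA/intrP[c ->] : i (x * w ^- k) \in Aint by rewrite rmorphM rpredM //; exact: wV.
  exact: rpred_int.
rewrite unfold_in ix -rmorphXn /eqAmod -rmorphB unfold_in pnatr_eq0.
rewrite eqn0Ngt prime_gt0 //= => h; exists ((x ^+ (l ^ f) - x) / l%:R).
  by rewrite fmorph_div rmorph_nat.
have l0 : l%:R != 0 :> F by rewrite -(fmorph_eq0 i) rmorph_nat pnatr_eq0 -lt0n prime_gt0.
by rewrite [l%:R * _]mulrC (divfK l0) [RHS]addrC subrK.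
Qed.

End CyclotomicField.

Section RootsInQS.
Variables (p : nat) (p_prime : prime p).

Lemma QS_prim_root n : exists z : QS p, (p ^ n)%N.-primitive_root z.
Proof.
have [F [i [w [wn uF]]]] := cyclotomic_unramified n p_prime.
have iwS : i w \in QS_pred p.
  by apply: subfield_gen_sub; exists F, i; split=> //; exists w.
exists (exist _ (i w) iwS : QS p).
rewrite -(fmorph_primitive_root (\val : {rmorphism QS p -> algC})) /=.
by rewrite fmorph_primitive_root.
Qed.

End RootsInQS.

(** * The cyclotomic character *)

HB.instance Definition _ (L : fieldType) (s : gal_group L) :=
  GRing.isZmodMorphism.Build L L (gal_fun s) (galB s).
HB.instance Definition _ (L : fieldType) (s : gal_group L) :=
  GRing.isMonoidMorphism.Build L L (gal_fun s) (gal1 s, galM s).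

(** * Compactness of the Galois group *)

Section Compactness.
Variable p : nat.
Local Notation G := (gal_group (QS p)).

(** Conjugates are roots of the minimal polynomial; clearing its denominators makes it visibly
    invariant, integers being fixed by every morphism. *)
Lemma gal_orbit_finite (x : QS p) :
  exists rs : seq algC, forall s : G, val (s x) \in rs.
Proof.
have [q [qE _ qroot]] := minCpolyP (val x).
have [r [a a0 qr]] := rat_poly_scale q.
have r0 : map_poly intr r != 0 :> {poly algC}.
  apply/eqP => r0; have : minCpoly (val x) != 0 by apply: monic_neq0; exact: minCpoly_monic.
  rewrite qE qr map_polyZ -map_poly_comp.
  rewrite (eq_map_poly (g := intr)) ?r0 ?scaler0 ?eqxx // => c.
  by rewrite /= ratr_int.
have rx : root (map_poly intr r) x.
  rewrite -(fmorph_root (\val : {rmorphism QS p -> algC})) -map_poly_comp.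
  rewrite (eq_map_poly (g := intr)); last by move=> c; exact: rmorph_int.
  have := root_minCpoly (val x); rewrite qE qr map_polyZ -map_poly_comp.
  rewrite rootZ ?fmorph_eq0 ?invr_eq0 ?intr_eq0 //.
  by rewrite (eq_map_poly (g := intr)) // => c; rewrite /= ratr_int.
have [rs rsE] := closed_field_poly_normal (map_poly intr r : {poly algC}).
exists rs => s; rewrite -root_prod_XsubC.
rewrite -(rootZ _ _ (_ : lead_coef (map_poly intr r : {poly algC}) != 0)) ?lead_coef_eq0 //.
rewrite -rsE.
have := rx; rewrite -(fmorph_root (gal_fun s)) -(fmorph_root (\val : {rmorphism QS p -> algC})).
rewrite -!map_poly_comp (eq_map_poly (g := intr)) // => c.
transitivity (\val (gal_fun s c%:~R) : algC) => //.
by rewrite (rmorph_int (gal_fun s)); exact: rmorph_int.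
Qed.

Lemma ultra_finite_range (T : Type) (V : eqType) (U : set_system T) (f : T -> V) (rs : seq V) :
  UltraFilter U -> U [set t | f t \in rs] -> exists v, U [set t | f t = v].
Proof.
move=> UU; have PU := @ultra_proper _ _ UU; elim: rs => [|r rs IH] Urs.
  by have [t] := filter_ex Urs.
have [|Ur] := in_ultra_setVsetC [set t | f t = r] UU; first by exists r.
apply: IH; apply: filterS (filterI Urs Ur) => t /= [].
by rewrite inE => /predU1P[].
Qed.

(** A cluster point: along an ultrafilter containing all cofinal segments, [u j x] is constant on a
    large set because orbits are finite. The limit of the inverses inverts the limit. *)
Lemma gal_compact (u : nat -> G) : exists t : G, forall (E : seq (QS p)) n,
  exists2 j, (n <= j)%N & forall x, x \in E -> t x = u j x.
Proof.
have [U [UU ooU]] := ultraFilterLemma eventually_filter.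
have PU := @ultra_proper _ _ UU.
have lim (v : nat -> G) x : exists y, U [set j | v j x = y].
  have [rs hrs] := gal_orbit_finite x.
  have [|y Uy] := @ultra_finite_range _ _ U (fun j => val (v j x)) rs UU.
    by apply: filterS filterT => j _; exact: hrs.
  have [j0 /= yE] := filter_ex Uy; exists (v j0 x).
  by apply: filterS Uy => j /= vE; apply: (@val_inj _ _ (QS p)); rewrite [RHS]yE; exact: vE.
pose t v x := sval (cid (lim v x)).
have tP (v : nat -> G) x : U [set j | v j x = t v x] by rewrite /t; case: cid.
have tK (v v' : nat -> G) : (forall j, cancel (v j) (v' j)) -> cancel (t v) (t v').
  move=> vv' x; have [j [/= <- <-]] := filter_ex (filterI (tP v x) (tP v' (t v x))).
  by rewrite vv'.
pose u' j := gal_inv (u j).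
have uu' : cancel (t u) (t u') by apply: tK => j; exact: gal_invK.
have u'u : cancel (t u') (t u) by apply: tK => j; exact: gal_invKV.
have tE : is_field_aut (t u).
  split; last by exists (t u').
  - move=> x y.
    have [j [/= <- [<- <-]]] := filter_ex (filterI (tP u (x + y)) (filterI (tP u x) (tP u y))).
    exact: galD.
  - move=> x y.
    have [j [/= <- [<- <-]]] := filter_ex (filterI (tP u (x * y)) (filterI (tP u x) (tP u y))).
    exact: galM.
  - by have /filter_ex[j /= <-] := tP u 1; exact: gal1.
exists (mk_gal tE) => E n.
have : U [set j | forall x, x \in E -> t u x = u j x].
  elim: E => [|y E IH]; first by apply: filterS filterT.
  apply: filterS (filterI (tP u y) IH) => j /= [ty tE'] x.
  by rewrite inE => /predU1P[->//|/tE'].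
have Un : U [set j | (n <= j)%N] by apply: ooU; exists n.
by move=> /(filterI Un)/filter_ex[j [nj hj]]; exists j.
Qed.

End Compactness.

Section CyclotomicCharacter.
Variables (p : nat) (p_prime : prime p).
Local Notation G := (gal_group (QS p)).

Definition nres (a : Zp p) n : nat := `|zres a n|%N.

Lemma pX_neq0 n : (p ^ n)%N%:Z != 0.
Proof. by rewrite eqz_nat expn_eq0 eqn0Ngt prime_gt0. Qed.

Lemma nresE a n : zres a n = (nres a n)%:Z.
Proof. by rewrite abszE ger0_norm // -(zres_mod a) modz_ge0 // pX_neq0. Qed.

Lemma nres_mod a n : (nres a n %% p ^ n)%N = nres a n.
Proof. by have /eqP := zres_mod a n; rewrite nresE modz_nat eqz_nat => /eqP. Qed.

Lemma nres_inj a b : (forall n, nres a n = nres b n) -> a = b.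
Proof. by move=> ab; apply: zres_inj => n; rewrite !nresE ab. Qed.

Lemma nres_le a m n : (m <= n)%N -> (nres a n %% p ^ m)%N = nres a m.
Proof.
by move=> /(zres_le a)/eqP; rewrite !nresE modz_nat eqz_nat => /eqP.
Qed.

Lemma nres_eq_le a b m n : (m <= n)%N -> nres a n = nres b n -> nres a m = nres b m.
Proof. by move=> mn ab; rewrite -(nres_le a mn) ab nres_le. Qed.

Lemma nres1 n : nres 1 n = (1 %% p ^ n)%N.
Proof. by apply/eqP; rewrite -eqz_nat -nresE -modz_nat. Qed.

Lemma nresM a b n : nres (a * b) n = ((nres a n * nres b n) %% p ^ n)%N.
Proof. by apply/eqP; rewrite -eqz_nat -nresE -modz_nat zresM !nresE. Qed.

Lemma nresD a b n : nres (a + b) n = ((nres a n + nres b n) %% p ^ n)%N.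
Proof. by apply/eqP; rewrite -eqz_nat -nresE -modz_nat zresD !nresE. Qed.

Lemma nresX a k n : nres (a ^+ k) n = ((nres a n ^ k) %% p ^ n)%N.
Proof.
elim: k => [|k IH]; first by rewrite expr0 nres1.
by rewrite exprS nresM IH modnMmr expnS.
Qed.

(** All primitive roots of order p^n are powers of a chosen one, hence share its exponent; the
    [p]-th power of a root of the next level then makes the exponents compatible. *)
Lemma cyclotomic_char_ex (s : G) : exists a : Zp p, forall n z,
  (p ^ n)%N.-primitive_root z -> s z = z ^ zres a n.
Proof.
pose z n := sval (cid (QS_prim_root p_prime n)).
have zP n : (p ^ n)%N.-primitive_root (z n) by rewrite /z; case: cid.
pose k n := sval (cid (mu_gal_power s (zP n))).
have kP n : s (z n) = z n ^+ k n by rewrite /k; case: cid.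
have kE n y : (p ^ n)%N.-primitive_root y -> s y = y ^+ k n.
  move=> yn; have [i ->] := prim_rootP (zP n) (prim_expr_order yn).
  by rewrite rmorphXn /= kP exprAC.
have kS n : ((k n.+1)%:Z = (k n)%:Z %[mod (p ^ n)%N%:Z])%Z.
  have yn : (p ^ n)%N.-primitive_root (z n.+1 ^+ p).
    have := dvdn_prim_root (zP n.+1) (_ : p ^ n %| p ^ n.+1)%N.
    by rewrite dvdn_exp2l // expnS mulnK ?expn_gt0 ?prime_gt0 //; apply.
  have /eqP := kE n _ yn; rewrite rmorphXn /= kP exprAC (eq_prim_root_expr yn).
  by rewrite !modz_nat => /eqP ->.
exists (mkZp kS) => n y yn; rewrite (kE n y yn) zres_mk modz_nat.
by rewrite -exprnP (prim_expr_mod yn).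
Qed.

Lemma cyclotomic_charP (s : G) n z : (p ^ n)%N.-primitive_root z ->
  s z = z ^+ nres (cyclotomic_char s) n.
Proof.
rewrite exprnP -nresE /cyclotomic_char; case: xgetP => [a _ /(_ n z) //|no].
by have [a ha] := cyclotomic_char_ex s; case: (no a).
Qed.

Lemma nres_cyclotomic_char (s : G) n z k : (p ^ n)%N.-primitive_root z ->
  s z = z ^+ k -> nres (cyclotomic_char s) n = (k %% p ^ n)%N.
Proof.
move=> zn /eqP; rewrite (cyclotomic_charP _ zn) (eq_prim_root_expr zn).
by rewrite nres_mod => /eqP.
Qed.

Lemma cyclotomic_charM (s t : G) :
  cyclotomic_char (s * t)%g = cyclotomic_char s * cyclotomic_char t.
Proof.
apply: nres_inj => n; have [z zn] := QS_prim_root p_prime n.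
rewrite nresM; apply: (nres_cyclotomic_char zn).
by rewrite gal_mulE (cyclotomic_charP t zn) rmorphXn /= (cyclotomic_charP s zn) exprM.
Qed.

Lemma cyclotomic_char1 : cyclotomic_char (1%g : G) = 1.
Proof.
apply: nres_inj => n; have [z zn] := QS_prim_root p_prime n.
by rewrite nres1; apply: (nres_cyclotomic_char zn); rewrite expr1.
Qed.

Lemma cyclotomic_charX (s : G) k :
  cyclotomic_char (s ^+ k)%g = cyclotomic_char s ^+ k.
Proof.
elim: k => [|k IH]; first by rewrite expg0 cyclotomic_char1.
by rewrite expgS cyclotomic_charM IH exprS.
Qed.

Lemma cyclotomic_charV (s : G) : cyclotomic_char s * cyclotomic_char (s^-1)%g = 1.
Proof. by rewrite -cyclotomic_charM mulgV cyclotomic_char1. Qed.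

Lemma galHP (s : G) : galH p s <-> cyclotomic_char s = 1.
Proof.
split=> [sH|s1].
  apply: nres_inj => n; have [z zn] := QS_prim_root p_prime n.
  rewrite nres1; apply: (nres_cyclotomic_char zn); rewrite expr1.
  by apply: sH; apply: subfield_gen_sub; exists n.
move=> x; pose E : {pred QS p} := fun y => s y == y.
move=> xF; suff : x \in E by move/eqP.
apply: subfield_gen_min xF => [|y [n yn]].
  split=> [|y z /eqP hy /eqP hz|y z /eqP hy /eqP hz]; apply/eqP.
  - exact: gal1.
  - by rewrite galB hy hz.
  - by rewrite galM galV hy hz.
by apply/eqP; rewrite (cyclotomic_charP s yn) s1 nres1 (prim_expr_mod yn) expr1.
Qed.

Lemma chi_GammaE (s : G) : chi_Gamma (qproj (galH p) s) = cyclotomic_char s.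
Proof.
rewrite /chi_Gamma; have [h hH ->] := qprojE (galH p) s.
by rewrite cyclotomic_charM (proj1 (galHP h) hH) mulr1.
Qed.

Lemma chi_Gamma_inj : injective (@chi_Gamma p).
Proof.
move=> g h; rewrite -(qreprK g) -(qreprK h) !chi_GammaE => gh.
apply/qprojP/galHP; rewrite cyclotomic_charM -gh -cyclotomic_charM mulVg.
exact: cyclotomic_char1.
Qed.

Lemma chi_Gamma1 : chi_Gamma (1%g : Gamma p) = 1.
Proof. by rewrite -(qproj1 (galH p)) chi_GammaE cyclotomic_char1. Qed.

Lemma chi_GammaM (g h : Gamma p) : chi_Gamma (g * h)%g = chi_Gamma g * chi_Gamma h.
Proof. by rewrite -(qreprK g) -(qreprK h) -qprojM !chi_GammaE cyclotomic_charM. Qed.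

Lemma chi_GammaX (g : Gamma p) k : chi_Gamma (g ^+ k)%g = chi_Gamma g ^+ k.
Proof.
elim: k => [|k IH]; first by rewrite expg0 chi_Gamma1.
by rewrite expgS chi_GammaM IH exprS.
Qed.

Lemma cyclotomic_char_near (s : G) n :
  \forall t \near s, nres (cyclotomic_char t) n = nres (cyclotomic_char s) n.
Proof.
have [z zn] := QS_prim_root p_prime n.
suff oU : open [set t : G | t z = s z].
  apply: filterS (open_nbhs_nbhs (conj oU _)) => // t /= tz.
  rewrite (nres_cyclotomic_char (k := nres (cyclotomic_char s) n) zn).
    by rewrite nres_mod.
  by rewrite tz (cyclotomic_charP s zn).
suff : gal_open [set t : G | t z = s z] by [].
by move=> t /= tz; exists [:: z] => t' /(_ z (mem_head _ _)) ->.
Qed.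

(** An automorphism of [algC] preserves [QS p], which is generated by the images of number fields
    under all their embeddings. *)
Lemma cyclotomic_char_surj n k : coprime k p ->
  exists s : G, nres (cyclotomic_char s) n = (k %% p ^ n)%N.
Proof.
move=> kp.
have [u uE] := @Qn_aut_exists k (p ^ n) (coprimeXr n kp).
have stable (v w : {rmorphism algC -> algC}) : cancel v w -> cancel w v ->
    forall x, x \in QS_pred p -> v x \in QS_pred p.
  move=> vw wv x xS; pose E : {pred algC} := fun y => v y \in QS_pred p.
  suff : x \in E by [].
  apply: subfield_gen_min xS => [|y].
    split; first by rewrite unfold_in /E rmorph1 rpred1.
    - by move=> a b Ea Eb; rewrite unfold_in /E rmorphB; apply: rpredB; [exact: Ea|exact: Eb].
    - by move=> a b Ea Eb; rewrite unfold_in /E fmorph_div; apply: rpred_div; [exact: Ea|exact: Eb].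
  move=> [F [i [uF [x' ->]]]]; apply: subfield_gen_sub.
  by exists F, (v \o i : {rmorphism F -> algC}); split=> //; exists x'.
have uS := stable u (algC_invaut u) (algC_autK u) (algC_invautK u).
have vS := stable (algC_invaut u) u (algC_invautK u) (algC_autK u).
pose s0 (x : QS p) : QS p := exist _ (u (val x)) (uS _ (valP x)).
pose s1 (x : QS p) : QS p := exist _ (algC_invaut u (val x)) (vS _ (valP x)).
have sE : is_field_aut s0.
  split.
  - by move=> x y; apply: val_inj; rewrite /= rmorphD.
  - by move=> x y; apply: val_inj; rewrite /= rmorphM.
  - by apply: val_inj; rewrite /= rmorph1.
  - exists s1 => x; apply: val_inj; [exact: algC_autK|exact: algC_invautK].
have [z zn] := QS_prim_root p_prime n.
exists (mk_gal sE); apply: (nres_cyclotomic_char zn).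
apply: val_inj; rewrite [RHS](rmorphXn (\val : {rmorphism QS p -> algC})) /=.
apply: uE; rewrite -(rmorphXn (\val : {rmorphism QS p -> algC})) /=.
by rewrite (prim_expr_order zn).
Qed.

End CyclotomicCharacter.

(** * Powers modulo powers of an odd prime *)

Lemma expn_coprime_mod (a x y N : nat) : coprime x y ->
  (a ^ x = 1 %[mod N] -> a ^ y = 1 %[mod N] -> a = 1 %[mod N])%N.
Proof.
move=> xy ax ay; have [x0|x0] := posnP x.
  by move: xy; rewrite x0 /coprime gcd0n => /eqP y1; rewrite y1 expn1 in ay.
have [[u v] /= uv] := coprimeP _ x0 xy.
have uxE : (u * x = (v * y).+1)%N by lia.
have pw t k : (a ^ t = 1 %[mod N] -> a ^ (k * t) = 1 %[mod N])%N.
  by move=> at1; rewrite mulnC expnM -modnXm at1 modnXm exp1n.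
by rewrite -(pw _ u ax) uxE expnS -modnMmr (pw _ v ay) modnMmr muln1.
Qed.

Section OddPrimePowers.
Local Open Scope nat_scope.
Variables (p : nat) (p_prime : prime p) (p_odd : odd p).

(** Binomial theorem: p^(2j+3) divides the terms with 2 <= i < p, and p^(3j+3) the term i = p, as p
    >= 3. *)
Lemma expn_prime_lift j u :
  exists w, (1 + p ^ j.+1 * u) ^ p = 1 + p ^ j.+2 * (u + p * w).
Proof.
set x := p ^ j.+1 * u.
have p3 : 2 < p by case: (p) p_prime p_odd => [|[|[|m]]].
have div3 : p ^ j.+3 %| \sum_(2 <= i < p.+1) 'C(p, i) * x ^ i.
  rewrite big_nat_cond; apply: dvdn_sum => i /andP[/andP[i2 ip] _].
  have xd k : p ^ (j.+1 * k) %| x ^ k by rewrite expnM dvdn_exp2r // dvdn_mulr.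
  have [{}ip|{}ip] := ltnP i p.
    have -> : j.+3 = 1 + j.+2 by [].
    rewrite expnD; apply: dvdn_mul; first by rewrite expn1 prime_dvd_bin // ltnW.
    by apply: dvdn_trans (xd _); rewrite dvdn_exp2l //; nia.
  rewrite dvdn_mull //; apply: dvdn_trans (xd _); rewrite dvdn_exp2l //; nia.
have /dvdnP[w wE] := div3; exists w.
rewrite expnDn -(big_mkord predT (fun i => 'C(p, i) * (1 ^ (p - i) * x ^ i))).
under eq_bigr => i _ do rewrite exp1n mul1n.
rewrite big_ltn // big_ltn ?ltnS ?prime_gt0 // bin0 bin1 expn0 expn1 wE /x.
by rewrite !expnS; ring.
Qed.

(** Each [p]-th power raises the valuation of a - 1 by exactly one when [p] does not divide [u], the
    leading digit being kept. *)
Lemma expn_prime_tower u k :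
  exists v, (1 + p * u) ^ p ^ k = 1 + p ^ k.+1 * (u + p * v).
Proof.
elim: k => [|k [v vE]]; first by exists 0; rewrite expn0 !expn1 muln0 addn0.
have [w wE] := expn_prime_lift k (u + p * v).
by exists (v + w); rewrite expnSr expnM vE wE -addnA -mulnDr.
Qed.

Lemma modn1E a : a = 1 %[mod p] -> exists u, a = 1 + p * u.
Proof.
move=> a1; exists (a %/ p); rewrite {1}(divn_eq a p) a1 modn_small ?prime_gt1 //.
by rewrite addnC mulnC.
Qed.

Lemma expn_prime_tower_mod a k : a = 1 %[mod p] -> a ^ p ^ k = 1 %[mod p ^ k.+1].
Proof.
move=> /modn1E[u ->]; have [v ->] := expn_prime_tower u k.
by rewrite addnC mulnC modnMDl.
Qed.

(** Write e = e' p^k with e' prime to [p]. The p^k-th power of 1 + p u is killed by e' and by p^n,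
    so it is 1, whereas its difference from 1 has valuation exactly k + 1. *)
Lemma expn_order_mod u e n : ~~ (p %| u) ->
  (1 + p * u) ^ e = 1 %[mod p ^ n.+1] -> p ^ n %| e.
Proof.
move=> pu; have [->|e0] := posnP e; first by rewrite dvdn0.
have [e' pe' eE] := pfactor_coprime p_prime e0; set k := logn p e in eE.
have [v vE] := expn_prime_tower u k.
rewrite eE [e' * _]mulnC expnM vE => b1.
have b2 : (1 + p ^ k.+1 * (u + p * v)) ^ p ^ n = 1 %[mod p ^ n.+1].
  by apply: expn_prime_tower_mod; rewrite addnC expnS -mulnA mulnC modnMDl.
have := expn_coprime_mod _ b1 b2; rewrite coprimeXr 1?coprime_sym // => /(_ isT)/eqP.
rewrite eqn_mod_dvd ?leq_addr // addKn Gauss_dvdl.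
  by rewrite dvdn_Pexp2l ?prime_gt1 // ltnS => nk; rewrite dvdn_mulr ?dvdn_exp2l.
rewrite coprimeXl // prime_coprime // dvdn_addl //; exact: dvdn_mulr.
Qed.

Lemma primitive_root_mod : exists2 r, coprime r p &
  forall a b, r ^ a = r ^ b %[mod p] -> a = b %[mod p.-1].
Proof.
pose rs := enum (predC1 (0%R : 'F_p)).
have p10 : 0 < p.-1 by rewrite -subn1 subn_gt0 prime_gt1.
have sz : size rs = p.-1.
  by rewrite -cardE cardC1 card_Fp.
have : has p.-1.-primitive_root%R rs.
  apply: has_prim_root => //; last by rewrite sz.
    apply/allP => x; rewrite mem_enum => x0.
    apply/unity_rootP; apply: (mulfI x0).
    by have := expf_card x; rewrite card_Fp // -exprS prednK ?prime_gt0 // mulr1.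
  exact: enum_uniq.
case/hasP => w; rewrite mem_enum => w0 wp; exists (val w).
  rewrite coprime_sym prime_coprime //; apply: contra w0 => pw; apply/eqP.
  apply: val_inj; apply/eqP; move: pw; rewrite /dvdn modn_small //.
  by have := ltn_ord w; rewrite [X in _ < X]Fp_cast.
move=> a b ab; apply/eqP; rewrite -(eq_prim_root_expr wp).
have nE k : (w ^+ k = (val w ^ k)%:R)%R by rewrite natrX natr_Zp.
rewrite !nE; apply/eqP; apply: val_inj.
by rewrite /= !val_Fp_nat // ab.
Qed.

End OddPrimePowers.

Section Residues.
Variables (p : nat) (p_prime : prime p).
Implicit Types a b c d : Zp p.

Lemma coprime_pred n : coprime p.-1 (p ^ n).
Proof.
apply: coprimeXr; rewrite -{2}(prednK (prime_gt0 p_prime)); exact: coprimenS.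
Qed.

Lemma zres_nat k n : zres (k%:R : Zp p) n = (k%:Z %% (p ^ n)%N%:Z)%Z.
Proof.
elim: k => [|k IH]; first by rewrite mulr0n; exact: zres_mk.
by rewrite -natr1 zresD IH zres1 modzDm -PoszD addn1.
Qed.

Lemma nres_addr n a b c : nres a n = nres b n -> nres (a + c) n = nres (b + c) n.
Proof. by move=> ab; rewrite !(nresD p_prime) ab. Qed.

Lemma nres_mulr n a b c : nres a n = nres b n -> nres (a * c) n = nres (b * c) n.
Proof. by move=> ab; rewrite !(nresM p_prime) ab. Qed.

Lemma nres_mull n a b c : nres a n = nres b n -> nres (c * a) n = nres (c * b) n.
Proof. by move=> ab; rewrite !(nresM p_prime) ab. Qed.

Lemma nres_exp n a b k : nres a n = nres b n -> nres (a ^+ k) n = nres (b ^+ k) n.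
Proof. by move=> ab; rewrite !(nresX p_prime) ab. Qed.

(** Division by [p] costs one digit: the quotient modulo p^n is read off [b] modulo p^(n+1). *)
Lemma zp_divp b : nres b 1 = 0%N -> exists a, b = p%:R * a.
Proof.
move=> b1.
have pn n : (p ^ n.+1)%N%:Z = p%:Z * (p ^ n)%N%:Z by rewrite expnS PoszM.
have p0 : p%:Z != 0 by rewrite eqz_nat -lt0n prime_gt0.
have bp n : zres b n.+1 = p%:Z * (zres b n.+1 %/ p%:Z)%Z.
  rewrite mulrC divzK // (nresE p_prime) dvdzE /= /dvdn; apply/eqP.
  by have := nres_le p_prime b (isT : 1 <= n.+1)%N; rewrite expn1 b1.
have fE n : ((zres b n.+2 %/ p%:Z)%Z = (zres b n.+1 %/ p%:Z)%Z %[mod (p ^ n)%N%:Z])%Z.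
  have /eqP := zresS b n.+1; rewrite [X in (X == _ %[mod _])%Z]bp [X in (_ == X %[mod _])%Z]bp.
  rewrite pn eqz_mod_dvd -mulrBr dvdz_mul2l // -eqz_mod_dvd; exact: eqP.
exists (mkZp fE); apply: zres_inj => n.
rewrite zresM zres_mk modzMmr.
by rewrite zres_nat modzMml -bp -zresP.
Qed.

End Residues.

(** * Exponents with respect to the generator [gamma] *)

Section GeneratorOfGamma1.
Variables (p : nat) (p_prime : prime p) (p_odd : odd p).
Variables (gamma : Gamma p) (gamma_gen : topological_generator gamma).
Local Notation G := (gal_group (QS p)).
Local Notation c := (chi_Gamma gamma).

Lemma nres_chi_coprime (g : Gamma p) n : coprime (nres (chi_Gamma g) n.+1) p.
Proof.
have := cyclotomic_charV p_prime (qrepr g) => /(congr1 (fun a : Zp p => nres a n.+1)).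
rewrite (nresM p_prime) (nres1 p_prime) => h.
have : coprime (nres (chi_Gamma g) n.+1 * nres (cyclotomic_char (qrepr g)^-1%g) n.+1) p.
  rewrite -(coprime_modl _ p) -(modn_dvdm _ (_ : p %| p ^ n.+1)%N) ?expnS ?dvdn_mulr //.
  rewrite -expnS h modn_dvdm ?expnS ?dvdn_mulr // coprime_modl.
  exact: coprime1n.
by rewrite coprimeMl => /andP[].
Qed.

Lemma chi_fermat (g : Gamma p) : nres (chi_Gamma g ^+ p.-1) 1 = 1%N.
Proof.
have p1 := prime_gt1 p_prime.
rewrite (nresX p_prime) expn1 -[RHS](modn_small p1); apply/eqP.
have rp := nres_chi_coprime g 0; set r := nres _ _ in rp *.
have r0 : (0 < r)%N by case: r rp => //; rewrite /coprime gcd0n => /eqP e; rewrite e in p1.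
have := fermat_little r p_prime; rewrite -{1}(prednK (prime_gt0 p_prime)) => /eqP.
rewrite !eqn_mod_dvd ?expn_gt0 ?r0 // ?leq_pexp2l //; last by rewrite -{1}[r]expn1 leq_pexp2l.
have -> : (r ^ p.-1.+1 - r = r * (r ^ p.-1 - 1))%N by rewrite mulnBr muln1 expnS.
by rewrite Gauss_dvdr // coprime_sym.
Qed.

Lemma Gamma1E (g : Gamma p) : Gamma1 g <-> nres (chi_Gamma g) 1 = 1%N.
Proof.
have e1 : nres (1 : Zp p) 1 = 1%N by rewrite (nres1 p_prime) modn_small ?expn1 ?prime_gt1.
split=> [[a ->]|g1].
  rewrite (nresD p_prime) e1 (nresM p_prime) /nres zres_nat expn1 modzz mul0n mod0n addn0.
  by rewrite modn_small ?prime_gt1.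
have [|a aE] := @zp_divp _ p_prime (chi_Gamma g - 1).
  by rewrite (nres_addr p_prime (b := 1)) ?subrr ?g1 ?e1 //; rewrite /nres zres_mk mod0z.
by exists a; rewrite -aE addrC subrK.
Qed.

Lemma gamma_nres1 : nres c 1 = 1%N.
Proof.
apply/Gamma1E; rewrite gamma_gen; apply: subset_closure => /=.
by exists 1%N; left; rewrite expg1.
Qed.

Lemma chi_pow (g : Gamma p) n k : nres (chi_Gamma g) 1 = 1%N ->
  nres (chi_Gamma g ^+ (p ^ n * k)) n = nres (1 : Zp p) n.
Proof.
move=> g1; rewrite exprM -(expr1n _ k); apply: (nres_exp p_prime).
rewrite (nresX p_prime) (nres1 p_prime).
case: n => [|n]; first by rewrite !expn0 !modn1.
have r1 : (nres (chi_Gamma g) n.+1 = 1 %[mod p])%N.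
  have := nres_le p_prime (chi_Gamma g) (isT : 1 <= n.+1)%N.
  by rewrite expn1 g1 => ->; rewrite modn_small ?prime_gt1.
have [u uE] := modn1E p_prime r1.
have [v vE] := expn_prime_tower p_prime p_odd u n.+1.
by rewrite uE vE expnS [(p * _)%N]mulnC -mulnA addnC mulnC modnMDl.
Qed.

(** Elements congruent to [g] form a neighbourhood, which meets the dense powers of [gamma]; the
    exponent -k is replaced by p^n k - k. *)
Lemma Gamma1_power n (g : Gamma p) : nres (chi_Gamma g) 1 = 1%N ->
  exists k, nres (chi_Gamma g) n = nres (c ^+ k) n.
Proof.
move=> /Gamma1E; rewrite gamma_gen.
pose B := [set r : Gamma p | nres (chi_Gamma r) n = nres (chi_Gamma g) n].
have nB : nbhs g B.
  apply: open_nbhs_nbhs; split=> //.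
  suff oV : open [set x : G | nres (cyclotomic_char x) n = nres (chi_Gamma g) n].
    congr (open _): oV; apply/seteqP.
    by split=> x /=; rewrite /B /= -(chi_GammaE p_prime).
  rewrite openE => x /= hx; rewrite /interior.
  by apply: filterS (cyclotomic_char_near p_prime x n) => y /=; rewrite hx.
move=> /(_ B nB)[h [[k hE] Bh]]; rewrite -Bh.
case: hE => -> {h Bh}; first by exists k; rewrite (chi_GammaX p_prime).
have kk : (k <= p ^ n * k)%N by rewrite leq_pmull // expn_gt0 prime_gt0.
exists (p ^ n * k - k)%N; set d := chi_Gamma _.
have dc : d * c ^+ k = 1.
  by rewrite -(chi_GammaX p_prime) -(chi_GammaM p_prime) mulVg (chi_Gamma1 p_prime).
rewrite -[c ^+ _]mul1r -dc -mulrA -exprD subnKC // -[in LHS](mulr1 d).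
by apply: (nres_mull p_prime); rewrite chi_pow // gamma_nres1.
Qed.

(** If chi(gamma) were 1 modulo p^2, so would be its powers, while 1 + p is a value of the character
    modulo p^2. *)
Lemma gamma_nres_split n : exists2 u, ~~ (p %| u)%N & nres c n.+2 = (1 + p * u)%N.
Proof.
have p1 := prime_gt1 p_prime.
have lt2 : (1 + p < p ^ 2)%N by nia.
have c1 m : (nres c m.+1 = 1 %[mod p])%N.
  have := nres_le p_prime c (isT : 1 <= m.+1)%N.
  by rewrite expn1 gamma_nres1 => ->; rewrite modn_small.
have [u uE] := modn1E p_prime (c1 n.+1); exists u => //.
apply/negP => /dvdnP[v vE].
have c2 : nres c 2 = nres (1 : Zp p) 2.
  rewrite -(nres_le p_prime c (isT : 2 <= n.+2)%N) uE vE (nres1 p_prime).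
  by rewrite (_ : 1 + p * (v * p) = v * p ^ 2 + 1)%N ?modnMDl //; ring.
have [|s sE] := @cyclotomic_char_surj p p_prime 2 (1 + p).
  by rewrite -(coprime_modl _ p) modnDr coprime_modl coprime1n.
rewrite -(chi_GammaE p_prime) modn_small // in sE.
have [|k kE] := @Gamma1_power 2 (qproj (galH p) s).
  by rewrite -(nres_le p_prime _ (isT : 1 <= 2)%N) sE expn1 modnDr modn_small.
have := nres_exp p_prime k c2; rewrite -kE sE expr1n (nres1 p_prime).
rewrite modn_small ?(leq_trans _ (leq_pexp2l _ (isT : 1 <= 2)%N)) ?expn1 ?(ltnW p1) //.
by lia.
Qed.

(** [k] approximates the exponent of the component of [g] in [Gamma1]; the (p-1)-st power discards
    the component in [Delta]. *)
Definition power_mod n (g : Gamma p) (k : nat) : Prop :=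
  nres (chi_Gamma g ^+ p.-1) n = nres (c ^+ (p.-1 * k)) n.

Lemma power_mod_ex n (g : Gamma p) : exists k, power_mod n g k.
Proof.
have [|k0 k0E] := @Gamma1_power n (g ^+ p.-1)%g.
  by rewrite (chi_GammaX p_prime) chi_fermat.
have p10 : (0 < p.-1)%N by rewrite -subn1 subn_gt0 prime_gt1.
have [[u v] /= uv] := coprimeP _ p10 (coprime_pred p_prime n).
(* [u] inverts p - 1 modulo p^n. *)
exists (u * k0)%N; rewrite /power_mod -(chi_GammaX p_prime) k0E.
have -> : (p.-1 * (u * k0) = k0 + p ^ n * (v * k0))%N.
  have uE : (u * p.-1 = (v * p ^ n).+1)%N by lia.
  by rewrite mulnA [(p.-1 * u)%N]mulnC uE mulSn mulnAC mulnC mulnA.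
rewrite exprD -[in LHS](mulr1 (c ^+ k0)); apply: (nres_mull p_prime).
by rewrite chi_pow // gamma_nres1.
Qed.

Lemma power_mod_uniq n (g : Gamma p) a b :
  power_mod n.+2 g a -> power_mod n.+2 g b -> (a = b %[mod p ^ n.+1])%N.
Proof.
wlog ab : a b / (a <= b)%N.
  by move=> W ha hb; case/orP: (leq_total a b) => /W h; [exact: h|symmetry; exact: h].
rewrite /power_mod => -> cab; symmetry; apply/eqP; rewrite eqn_mod_dvd //.
pose d := chi_Gamma (gamma^-1)%g.
have dc k : c ^+ k * d ^+ k = 1.
  by rewrite -exprMn -(chi_GammaM p_prime) mulgV (chi_Gamma1 p_prime) expr1n.
have := nres_mulr p_prime (d ^+ (p.-1 * a)) cab.
have bE : (p.-1 * b = p.-1 * a + p.-1 * (b - a))%N by rewrite -mulnDr subnKC.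
rewrite bE exprD mulrAC !dc mul1r.
have [u pu uE] := gamma_nres_split n.
rewrite (nresX p_prime) uE (nres1 p_prime) => /esym/(expn_order_mod p_prime p_odd pu).
by rewrite Gauss_dvdr // coprime_sym (coprime_pred p_prime).
Qed.

Lemma power_modM n (g h : Gamma p) a b :
  power_mod n g a -> power_mod n h b -> power_mod n (g * h)%g (a + b)%N.
Proof.
rewrite /power_mod (chi_GammaM p_prime) exprMn mulnDr exprD !(nresM p_prime).
by move=> -> ->.
Qed.

Lemma power_mod_gamma n k : power_mod n (gamma ^+ k)%g k.
Proof. by rewrite /power_mod (chi_GammaX p_prime) -exprM mulnC. Qed.

Lemma power_mod_Delta n (g : Gamma p) : Delta g -> power_mod n g 0%N.
Proof. by rewrite /power_mod muln0 => ->. Qed.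

End GeneratorOfGamma1.

(** * The subgroup [Delta] and open stabilizers *)

Section DeltaAndContinuity.
Variables (p : nat) (p_prime : prime p) (p_odd : odd p).
Local Notation G := (gal_group (QS p)).

(* Otherwise some [u j] with [chi (u j) ^ (p - 1) = 1] modulo [p ^ j] moves [y] for every [j], and
   a cluster point of the [u j] lies over [Delta] but moves [y]. *)
Lemma stabilizer_level (M : dmod p G) (y : M) :
  (forall h, Delta (qproj (galH p) h) -> dact h y = y) ->
  exists n, forall g : G,
    nres (cyclotomic_char g ^+ p.-1) n = nres (1 : Zp p) n -> dact g y = y.
Proof.
move=> yD; apply: contrapT => no.
have ex n : exists g : G, nres (cyclotomic_char g ^+ p.-1) n = nres (1 : Zp p) n /\
    dact g y <> y.
  apply: contrapT => no'; apply: no; exists n => g gn; apply: contrapT => gy.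
  by apply: no'; exists g.
pose u n := sval (cid (ex n)).
have uP n : nres (cyclotomic_char (u n) ^+ p.-1) n = nres (1 : Zp p) n /\
    dact (u n) y <> y by exact: svalP (cid (ex n)).
have [t tP] := gal_compact u.
have ty : dact t y = y.
  apply: yD; rewrite /Delta /= (chi_GammaE p_prime).
  apply: (nres_inj p_prime) => n; have [z zn] := QS_prim_root p_prime n.
  have [j nj tz] := tP [:: z] n.
  have tuj : nres (cyclotomic_char t) n = nres (cyclotomic_char (u j)) n.
    rewrite -(nres_mod p_prime (cyclotomic_char (u j))).
    apply: (nres_cyclotomic_char p_prime zn).
    by rewrite tz ?mem_head // (cyclotomic_charP p_prime _ zn).
  rewrite (nres_exp p_prime _ tuj).
  exact: (nres_eq_le p_prime nj (uP j).1).
have [E tE] : exists E : seq (QS p), forall g : G,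
    (forall x, x \in E -> g x = t x) -> dact g y = dact t y.
  have := dmod_cont y t; rewrite /prop_near1 nbhsE => -[U [oU Ut] UE].
  have : gal_open U by exact: oU.
  by move=> /(_ t Ut)[E hE]; exists E => g /hE/UE.
have [j _ jE] := tP E 0%N.
apply: (uP j).2; rewrite -[RHS]ty; apply: tE => x xE.
by rewrite jE.
Qed.

Lemma DeltaM (g h : Gamma p) : Delta g -> Delta h -> Delta (g * h)%g.
Proof.
by rewrite /Delta /= (chi_GammaM p_prime) exprMn => -> ->; rewrite mulr1.
Qed.

Lemma DeltaV (g : Gamma p) : Delta g -> Delta (g^-1)%g.
Proof.
rewrite /Delta /= => g1; rewrite -[LHS]mul1r -g1 -exprMn.
by rewrite -(chi_GammaM p_prime) mulgV (chi_Gamma1 p_prime) expr1n.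
Qed.

Lemma Delta1 : Delta (1%g : Gamma p).
Proof. by rewrite /Delta /= (chi_Gamma1 p_prime) expr1n. Qed.

(** The quotient is killed by p - 1 and, being 1 modulo [p], by p^n modulo p^n; these exponents are
    coprime. *)
Lemma Delta_nres_inj (g h : Gamma p) : Delta g -> Delta h ->
  nres (chi_Gamma g) 1 = nres (chi_Gamma h) 1 -> g = h.
Proof.
move=> Dg Dh gh; have Dd := DeltaM (DeltaV Dg) Dh; set d := (g^-1 * h)%g in Dd.
have d1 : nres (chi_Gamma d) 1 = 1%N.
  rewrite /d (chi_GammaM p_prime) -(nres_mull p_prime _ gh).
  rewrite -(chi_GammaM p_prime) mulVg (chi_Gamma1 p_prime) (nres1 p_prime).
  by rewrite modn_small ?expn1 ?prime_gt1.
suff dE : chi_Gamma d = 1.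
  rewrite -[LHS]mulg1 -[RHS](mulKVg g) -/d; congr (_ * _)%g.
  by apply: (chi_Gamma_inj p_prime); rewrite dE (chi_Gamma1 p_prime).
apply: (nres_inj p_prime) => n; rewrite (nres1 p_prime) -(nres_mod p_prime).
apply: (expn_coprime_mod (coprime_pred p_prime n)).
  by rewrite -(nresX p_prime) Dd (nres1 p_prime).
rewrite -(nresX p_prime) -[(p ^ n)%N in LHS]muln1 (chi_pow p_prime p_odd _ _ d1).
exact: nres1.
Qed.

(** [fset_set] of an infinite set is empty by convention; finiteness makes the sum in [idem] range
    over [Delta]. *)
Lemma finite_Delta : finite_set (@Delta p).
Proof.
pose inv (k : nat) : Gamma p :=
  xget 1%g [set g | Delta g /\ nres (chi_Gamma g) 1 = k].
apply: (@sub_finite_set _ _ (inv @` `I_p)); last exact/finite_image/finite_II.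
move=> g Dg; exists (nres (chi_Gamma g) 1).
  by rewrite /= -(nres_mod p_prime) expn1 ltn_pmod ?prime_gt0.
rewrite /inv; case: xgetP => [h _ [Dh hg]|/(_ g)]; last by case.
exact: Delta_nres_inj.
Qed.

Lemma mem_Delta (g : Gamma p) : g \in fset_set (@Delta p) <-> Delta g.
Proof. by rewrite in_fset_set ?inE //; exact: finite_Delta. Qed.

(** The bounds make the order of [Delta] prime to [p], hence invertible on [p]-primary modules. *)
Lemma size_Delta : (0 < size (fset_set (@Delta p)) < p)%N.
Proof.
apply/andP; split.
  by rewrite -has_predT; apply/hasP; exists 1%g => //; apply/mem_Delta; exact: Delta1.
rewrite -(size_map (fun g : Gamma p => nres (chi_Gamma g) 1)).
have sub : {subset [seq nres (chi_Gamma g) 1 | g <- fset_set (@Delta p)] <= iota 1 p.-1}.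
  move=> _ /mapP[g _ ->]; rewrite mem_iota add1n (prednK (prime_gt0 p_prime)).
  have xp : (nres (chi_Gamma g) 1 < p)%N.
    by rewrite -(nres_mod p_prime) expn1 ltn_pmod ?prime_gt0.
  rewrite xp andbT lt0n; apply: contraTneq (nres_chi_coprime p_prime g 0) => ->.
  by rewrite /coprime gcd0n neq_ltn prime_gt1 ?orbT.
apply: leq_ltn_trans (uniq_leq_size _ sub) _; last first.
  by rewrite size_iota prednK ?prime_gt0.
rewrite map_inj_in_uniq ?fset_uniq // => g h /mem_Delta Dg /mem_Delta Dh.
exact: Delta_nres_inj.
Qed.

(* The Teichmueller lift of a primitive root: a cluster point of the [g ^ (p ^ j)]. *)
Lemma Delta_generator : exists2 d : Gamma p, Delta d &
  forall a b, chi_Gamma d ^+ a = chi_Gamma d ^+ b -> (a = b %[mod p.-1])%N.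
Proof.
have p0 := prime_gt0 p_prime.
have [r rp rinj] := primitive_root_mod p_prime.
have [g gE] := cyclotomic_char_surj p_prime 1 rp.
have [t tP] := gal_compact (fun j => g ^+ (p ^ j))%g.
have tn n : exists2 j, (n <= j)%N &
    nres (cyclotomic_char t) n = nres (cyclotomic_char g ^+ (p ^ j)) n.
  have [z zn] := QS_prim_root p_prime n.
  have [j nj tz] := tP [:: z] n; exists j => //.
  rewrite -(nres_mod p_prime (_ ^+ _)); apply: (nres_cyclotomic_char p_prime zn).
  by rewrite tz ?mem_head // (cyclotomic_charP p_prime _ zn) (cyclotomic_charX p_prime).
exists (qproj (galH p) t).
  rewrite /Delta /= (chi_GammaE p_prime); apply: (nres_inj p_prime) => n.
  have [j nj /(nres_exp p_prime p.-1) ->] := tn n.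
  rewrite -exprM mulnC exprM -(chi_GammaE p_prime) -(chi_GammaX p_prime).
  rewrite -(subnKC nj) expnD chi_pow //.
  by rewrite (chi_GammaX p_prime) (chi_fermat p_prime).
move=> a b; rewrite (chi_GammaE p_prime) => ab.
have [j _ tj] := tn 1%N.
have := congr1 (fun x : Zp p => nres x 1) ab.
rewrite (nres_exp p_prime a tj) (nres_exp p_prime b tj) -!exprM.
rewrite !(nresX p_prime) gE expn1 !modnXm => /rinj.
(* Since p = 1 modulo p - 1, passing to [g ^+ (p ^ j)] keeps exponents modulo p - 1. *)
have pj k : (p ^ j * k = k %[mod p.-1])%N.
  rewrite -modnMml -modnXm -{1}(prednK p0) -addn1 modnDl modnXm exp1n modnMml.
  by rewrite mul1n.
by rewrite !pj.
Qed.

End DeltaAndContinuity.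

(** * Eigenspaces and the fiber *)

Section DifferenceSurjective.
Variables (p : nat) (p_prime : prime p) (p_odd : odd p).
Variables (gamma : Gamma p) (gamma_gen : topological_generator gamma).
Local Notation G := (gal_group (QS p)).
Local Notation gam := (qrepr gamma).

Lemma power_mod_level n (g : G) k : power_mod gamma n (qproj (galH p) g) k ->
  nres (cyclotomic_char ((gam ^+ k)^-1 * g)%g ^+ p.-1) n = nres (1 : Zp p) n.
Proof.
rewrite /power_mod (chi_GammaE p_prime) (cyclotomic_charM p_prime) exprMn.
move=> /(nres_mull p_prime (cyclotomic_char (gam ^+ k)^-1%g ^+ p.-1)) ->.
rewrite [(p.-1 * k)%N]mulnC exprM -exprMn -(cyclotomic_charX p_prime) mulrC.
by rewrite (cyclotomic_charV p_prime) expr1n.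
Qed.

Lemma power_mod_act n (M : dmod p G) (y : M) g k :
  (forall g : G, nres (cyclotomic_char g ^+ p.-1) n = nres (1 : Zp p) n -> dact g y = y) ->
  power_mod gamma n (qproj (galH p) g) k -> dact g y = dact (gam ^+ k)%g y.
Proof.
move=> yn /power_mod_level/yn gy.
by rewrite -[in RHS]gy -dactM mulKVg.
Qed.

(* With [y] fixed modulo level [n] and killed by [p ^ k], the partial sums
   [S j = \sum_(i < j) gamma ^ i y] depend only on [j] modulo [p ^ (n + k + 1)], so that
   [g |-> S j], for [g = gamma ^ j] modulo a high level, is a cocycle on the whole group. *)
Lemma gamma_sub1_surjective (M : dmod p G) (y : M) : dinjective M ->
  (forall h, Delta (qproj (galH p) h) -> dact h y = y) ->
  exists2 x : M, forall h, Delta (qproj (galH p) h) -> dact h x = x & y = dact gam x - x.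
Proof.
move=> injM yD.
have [n yn] := stabilizer_level p_prime yD.
have [k yk] := dmod_primary y.
(* Exponents at level [L] are unique modulo [P]. Blocks of p^n terms of the sum agree, and p^k of
   them cancel, so [P] is a period. *)
pose L := (n + k).+2; pose P := (p ^ (n + k).+1)%N.
pose a i := dact (gam ^+ i)%g y.
pose S j := \sum_(i < j) a i.
have aD i j : dact (gam ^+ i)%g (a j) = a (i + j)%N by rewrite /a -dactM -expgnDr.
have dact_sum g j : dact g (S j) = \sum_(i < j) dact g (a i).
  exact: (big_morph _ (@dactD _ _ M g) (dact0 M g)).
have SD i j : S (i + j)%N = S i + dact (gam ^+ i)%g (S j).
  rewrite dact_sum /S big_split_ord /=; congr (_ + _).
  by apply: eq_bigr => l _; rewrite aD.
have fixS t j : dact (gam ^+ (p ^ n * t))%g (S j) = S j.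
  rewrite dact_sum; apply: eq_bigr => i _; rewrite aD addnC -aD; congr dact.
  apply: yn; rewrite (cyclotomic_charX p_prime) -exprM mulnC exprM.
  rewrite -(chi_GammaE p_prime) -(chi_GammaX p_prime) (chi_pow p_prime p_odd) //.
  by rewrite (chi_GammaX p_prime) (chi_fermat p_prime).
have Sp t : S (p ^ n * t)%N = S (p ^ n)%N *+ t.
  elim: t => [|t IH]; first by rewrite muln0 /S big_ord0 mulr0n.
  by have := fixS 1%N; rewrite muln1 => fix1; rewrite mulnS SD fix1 IH mulrS.
have Sk j : S j *+ p ^ k = 0.
  by rewrite -sumrMnl big1 // => i _; rewrite -dactMn yk dact0.
have SP t r : S (P * t + r)%N = S r.
  have -> : (P * t = p ^ n * (p ^ k * (p * t)))%N by rewrite /P expnSr expnD -!mulnA.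
  by rewrite SD Sp fixS mulrnA Sk mul0rn add0r.
have Smod i j : (i = j %[mod P])%N -> S i = S j.
  by move=> ij; rewrite (divn_eq i P) (divn_eq j P) ![(_ * P)%N]mulnC !SP ij.
pose lam (g : G) := sval (cid (power_mod_ex p_prime p_odd gamma_gen L (qproj (galH p) g))).
have lamP g : power_mod gamma L (qproj (galH p) g) (lam g).
  exact: svalP (cid (power_mod_ex p_prime p_odd gamma_gen L (qproj (galH p) g))).
have cE g j : power_mod gamma L (qproj (galH p) g) j -> S (lam g) = S j.
  move=> gj; apply: Smod.
  exact: (power_mod_uniq p_prime p_odd gamma_gen (lamP g) gj).
have qX i : qproj (galH p) (gam ^+ i)%g = (gamma ^+ i)%g.
  by elim: i => [|i IH]; rewrite ?expg0 // !expgS qprojM qreprK IH.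
(* Each term is moved by g gamma^i, whose exponent is [lam g + i]. *)
have actS g j : dact g (S j) = dact (gam ^+ lam g)%g (S j).
  rewrite !dact_sum; apply: eq_bigr => i _; rewrite aD /a -dactM.
  apply: (power_mod_act yn); rewrite qprojM.
  have := power_modM p_prime (lamP g) (power_mod_gamma p_prime gamma L i).
  by rewrite -qX; apply: nres_eq_le => //; rewrite /L; lia.
have [|||x xE] := @injective_cocycle p G M (fun g => S (lam g)) k p_prime injM.
- move=> g h; rewrite actS -SD; apply: cE; rewrite qprojM.
  exact: (power_modM p_prime).
- move=> g; apply: filterS (cyclotomic_char_near p_prime g L) => h hg.
  apply: cE; rewrite /power_mod -(lamP g) !(chi_GammaE p_prime).
  exact: nres_exp.
- by move=> g; rewrite expnSr mulrnA Sk mul0rn.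
(* The cocycle is the empty sum over [Delta], and its value at [gam] is the one-term sum [y]. *)
exists x => [h hD|].
  apply/eqP; rewrite -subr_eq0 -xE (cE h 0%N); first by rewrite /S big_ord0.
  exact: power_mod_Delta.
rewrite -xE (cE gam 1%N); first by rewrite /S big_ord1 /a expg0 dact1.
by have := power_mod_gamma p_prime gamma L 1; rewrite expg1 qreprK.
Qed.

End DifferenceSurjective.

Section Idempotent.
Variables (p : nat) (p_prime : prime p) (p_odd : odd p).
Implicit Types (M : dmod p (Gamma p)) (j : 'Z_p.-1).

Lemma pred_gt1 : (1 < p.-1)%N.
Proof. by case: p p_prime p_odd => [|[|[|]]]. Qed.

Lemma omega_powNK j d : Delta d -> omega_pow (- j) d * omega_pow j d = 1.
Proof.
move=> Dd; rewrite /omega_pow -exprD.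
have /dvdnP[q ->] : (p.-1 %| (- j)%R + j)%N.
  have := congr1 val (addNr j); rewrite /= => h; rewrite /dvdn -[X in (_ %% X)%N](Zp_cast pred_gt1).
  by rewrite h.
by rewrite mulnC exprM Dd expr1n.
Qed.

Lemma omega_powM j d e : omega_pow j (d * e)%g = omega_pow j d * omega_pow j e.
Proof. by rewrite /omega_pow (chi_GammaM p_prime) exprMn. Qed.

Lemma zscale_nat (K : topGroupType) (M : dmod p K) (x : M) k :
  zscale (k%:R) x = x *+ k.
Proof.
have [n xn] := dmod_primary x.
by rewrite (zscaleE _ xn) zres_nat mulrz_mod.
Qed.

Lemma zscale0 (K : topGroupType) (M : dmod p K) a : zscale a (0 : M) = 0.
Proof. by apply: (addrI (zscale a (0 : M))); rewrite -zscaleD !addr0. Qed.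

Lemma zscale_sum (K : topGroupType) (M : dmod p K) a I (r : seq I) (F : I -> M) :
  zscale a (\sum_(i <- r) F i) = \sum_(i <- r) zscale a (F i).
Proof. exact: (big_morph _ (@zscaleD _ _ M a) (zscale0 M a)). Qed.

Lemma mulr_zp_inv_pred : p.-1%:R * zp_inv (p.-1%:R : Zp p) = 1.
Proof.
suff [b ab] : exists b : Zp p, p.-1%:R * b = 1 by rewrite (zp_invE ab).
(* 1/(p - 1) = -(1 + p + p^2 + ...). *)
pose f n : int := - (\sum_(i < n) p ^ i)%N%:Z.
have fE n : (f n.+1 = f n %[mod (p ^ n)%N%:Z])%Z.
  by rewrite /f big_ord_recr /= PoszD opprD addrC -mulN1r modzMDl.
exists (mkZp fE); apply: zres_inj => n; rewrite zresM zres_nat zres_mk modzMm zres1.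
rewrite /f mulrN -PoszM -predn_exp predn_int ?expn_gt0 ?prime_gt0 // opprB.
by rewrite -mulN1r addrC modzMDl.
Qed.

(** Translation by [d] permutes the summands. *)
Lemma idem_eigen j M (x : M) d : Delta d ->
  dact d (idem j x) = zscale (omega_pow j d) (idem j x).
Proof.
move=> Dd; rewrite /idem zscale_dact -zscaleA mulrC zscaleA; congr zscale.
rewrite (big_morph _ (@dactD _ _ M d) (dact0 M d)) zscale_sum.
have perm : perm_eq (fset_set (@Delta p)) [seq (d * e)%g | e <- fset_set (@Delta p)].
  apply: uniq_perm; rewrite ?fset_uniq ?(map_inj_uniq (mulgI d)) ?fset_uniq // => e.
  apply/idP/mapP => [/mem_Delta De|[e' /mem_Delta De' ->]]; last first.
    by apply/(mem_Delta p_prime p_odd)/(DeltaM p_prime) => //; exact: De'.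
  exists (d^-1 * e)%g; last by rewrite mulKVg.
  by apply/(mem_Delta p_prime p_odd)/(DeltaM p_prime); [exact: DeltaV|exact: De].
rewrite [RHS](perm_big _ perm) big_map; apply: eq_bigr => e _.
rewrite zscale_dact -zscaleA dactM omega_powM mulrA [_ * omega_pow (- j) d]mulrC.
by rewrite omega_powNK // mul1r.
Qed.

(** On the eigenspace [idem] is multiplication by |Delta|/(p - 1), so with [u] inverse to |Delta|
    modulo p^k a preimage of [x] is u (p - 1) x. *)
Lemma eigen_idem j M (x : M) :
  (forall d, Delta d -> dact d x = zscale (omega_pow j d) x) ->
  exists y, x = idem j y.
Proof.
move=> xD; have [k xk] := dmod_primary x.
pose D := #|` fset_set (@Delta p)|%fset.
have idx : idem j x = zscale (zp_inv p.-1%:R) (x *+ D).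
  rewrite /idem; congr zscale.
  rewrite (eq_big_seq (fun=> x)); first by rewrite big_const_seq count_predT iter_addr_0.
  move=> d /(mem_Delta p_prime p_odd) Dd; rewrite xD // -zscaleA omega_powNK //.
  exact: zscale1.
have idMn t : idem j (x *+ t) = zscale (zp_inv p.-1%:R) (x *+ (D * t)).
  elim: t => [|t IH]; first by rewrite muln0 !mulr0n zscale0; exact: (dfun0 (idem_hom j M)).
  by rewrite mulrS idemD IH idx -zscaleD -mulrnDr mulnS.
have /andP[D0 Dp] := size_Delta p_prime p_odd.
have co : coprime D (p ^ k).
  by apply: coprimeXr; rewrite coprime_sym prime_coprime // gtnNdvd.
have [[u v] /= uv] := coprimeP _ D0 co.
exists (x *+ (u * p.-1)); rewrite idMn.
have -> : x *+ (D * (u * p.-1)) = zscale p.-1%:R x.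
  rewrite zscale_nat.
  have -> : (D * (u * p.-1) = p.-1 + p ^ k * (v * p.-1))%N.
    have -> : (D * (u * p.-1) = (u * D) * p.-1)%N by ring.
    have -> : (u * D = (v * p ^ k).+1)%N by rewrite -addn1 -[1%N]uv subnKC // ltnW // -subn_gt0 uv.
    by rewrite mulSn; congr (_ + _)%N; ring.
  by rewrite mulrnDr mulrnA xk mul0rn addr0.
by rewrite -zscaleA mulrC mulr_zp_inv_pred zscale1.
Qed.

End Idempotent.

Lemma zscaleB (p : nat) (K : topGroupType) (M : dmod p K) a (x y : M) :
  zscale a (x - y) = zscale a x - zscale a y.
Proof. by rewrite -[in RHS](subrK y x) [in RHS]zscaleD addrK. Qed.

Lemma val_dimageD (p : nat) (K : topGroupType) (M : dmod p K) (e : dhom M M)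
  (x y : dimage e) : val (x + y) = val x + val y.
Proof. by []. Qed.

Lemma val_invariantsD (p : nat) (K : topGroupType) (N : normal_subgroup K)
  (M : dmod p K) (x y : invariants N M) : val (x + y) = val x + val y.
Proof. by []. Qed.

(** The two complexes live over different groups, so [k] is a family of plain additive maps,
    equivariant only once the actions are forgotten. *)
Lemma kernel_act_sub (p : nat) (K : topGroupType) (g : Gamma p) (c : Zp p)
    (X : cplx p K) (Y : cplx p (Gamma p)) (k : forall n, X n -> Y n) :
  (forall n x y, k n (x + y) = k n x + k n y) ->
  (forall n x, k n (cd X n x) = cd Y n (k (n - 1) x)) ->
  (forall n, injective (k n)) ->
  (forall n x, dact g (k n x) - zscale c (k n x) = 0) ->
  (forall n (y : Y n), dact g y - zscale c y = 0 -> exists x, k n x = y) ->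
  (forall n (z : Y n), exists y, dact g y - zscale c y = z) ->
  exists f : cmap (forget_cplx X) (fib (act_sub g c Y)), quasi_iso f.
Proof.
move=> kD kd inj k0 ker sur.
pose h n := @DHom _ _ (forget (X n)) (forget (Y n)) (k n) (kD n) (fun _ _ => erefl).
pose kc := @CMap _ _ (forget_cplx X) (forget_cplx Y) h kd.
have fd n (x : forget_cplx X (n - 1)) :
    dcomp (dinl (forget (Y n)) (forget (Y (n - 1)))) (kc n) (cd (forget_cplx X) n x) =
    cd (fib (act_sub g c Y)) n (dcomp (dinl _ _) (kc (n - 1)) x).
  congr (_, _); first exact: kd.
  by rewrite dfun0 subr0; symmetry; exact: k0.
exists (@CMap _ _ (forget_cplx X) (fib (act_sub g c Y)) _ fd).
exact: (@kernel_quasi_iso _ _ _ _ _ kc (act_sub g c Y)).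
Qed.

Section TwistedInvariants.
Variables (p : nat) (p_prime : prime p) (p_odd : odd p).
Variables (theta : zpchar p (Gamma p)) (m : 'Z_p.-1).
Hypothesis theta_omega : restricts_to_omega theta m.
Local Notation G := (gal_group (QS p)).
Local Notation H := (galH p).
Local Notation tw := (@twist p G H theta).
Local Notation theta' := (zchar_inv theta).

Lemma zchar_inv_omega d : Delta d -> theta' d = omega_pow (- m) d.
Proof.
by move=> Dd; apply: zp_invE; rewrite theta_omega // mulrC omega_powNK.
Qed.

Lemma twist_fixE (M : dmod p G) g (x : M) :
  dact g (x : tw M) = x <-> dact g x = zscale (theta' (qproj H g)) x.
Proof.
rewrite twist_actE; split=> [gx|->]; last exact: zscale_char_inv.
by rewrite -[in RHS]gx zscale_inv_char.
Qed.

Lemma qproj_galH (h : G) : H h -> qproj H h = 1%g.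
Proof.
by move=> Hh; rewrite -(qproj1 H); apply/qprojP; rewrite mulg1; exact: nsubV.
Qed.

Lemma val_zscale_inv (M : dmod p G) a (x : invariants H M) :
  val (zscale a x) = zscale a (val x).
Proof. exact: zscale_additive. Qed.

(** The elements over [Delta] include [H], which lies over 1 and on which the twist is trivial; the
    remaining condition is the eigenvalue equation that cuts out the image of the idempotent. *)
Lemma twist_fix_eigenspace (M : dmod p G) (x : M) :
  (forall h, Delta (qproj H h) -> dact h (x : tw M) = x) <->
  exists w : eigenspace (- m) (invariants H M), val (val w) = x.
Proof.
split=> [xD|[w <-] h hD].
  have xH : inv_subgrp H M x.
    move=> h Hh; have hD : Delta (qproj H h) by rewrite qproj_galH //; exact: Delta1.
    have /twist_fixE -> := xD h hD.
    by rewrite qproj_galH // zchar1 zscale1.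
  have [|y yE] := @eigen_idem p p_prime p_odd (- m) (invariants H M) (sgrp_in xH).
    move=> d Dd; apply: sgrp_eq; rewrite val_zscale_inv -[in LHS](qreprK d) inv_actE /=.
    have /twist_fixE -> : dact (qrepr d) (x : tw M) = x by apply: xD; rewrite qreprK.
    by rewrite qreprK zchar_inv_omega.
  have wE : image_subgrp (idem_hom (- m) (invariants H M)) (sgrp_in xH) by exists y.
  by exists (sgrp_in wE).
apply/twist_fixE; rewrite -inv_actE zchar_inv_omega // -val_zscale_inv; congr val.
have [y ->] := sgrpP w.
exact: (@idem_eigen p p_prime p_odd (- m) (invariants H M) y _ hD).
Qed.

Variables (gamma : Gamma p) (gamma_gen : topological_generator gamma).
Local Notation gam := (qrepr gamma).
Definition difference (M : dmod p G) (w : eigenspace (- m) (invariants H M)) :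
  eigenspace (- m) (invariants H M) := dact gamma w - zscale (theta' gamma) w.

Lemma val_difference (M : dmod p G) (w : eigenspace (- m) (invariants H M)) :
  val (val (difference w)) = dact gam (val (val w)) - zscale (theta' gamma) (val (val w)).
Proof.
transitivity (dact gam (val (val w)) - val (val (zscale (theta' gamma) w))) => //.
congr (_ - _); rewrite -val_zscale_inv; congr val.
exact: (@zscale_additive _ _ _ (eigenspace (- m) (invariants H M)) (invariants H M) val).
Qed.

(** The stabilizer has a finite level, at which every [g] acts as a power of [gam]. *)
Lemma difference_ker (M : dmod p G) (w : eigenspace (- m) (invariants H M)) :
  difference w = 0 <-> inv_subgrp (total_subgroup G) (tw M) (val (val w)).
Proof.
have -> : difference w = 0 <-> dact gam (val (val w) : tw M) = val (val w).
  rewrite twist_fixE qreprK; split=> [w0|gw].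
    by apply/eqP; rewrite -subr_eq0 -val_difference w0.
  by do 2?apply: sgrp_eq; rewrite val_difference gw subrr.
split=> [gw g _|]; last by apply.
have wD := (twist_fix_eigenspace _).2 (ex_intro _ w erefl).
have [n yn] := stabilizer_level p_prime wD.
have [k gk] := power_mod_ex p_prime p_odd gamma_gen n (qproj H g).
rewrite (power_mod_act p_prime yn gk).
by elim: k {gk} => [|k IH]; rewrite ?expg0 ?dact1 // expgS dactM IH.
Qed.

Lemma difference_surjective (M : dmod p G) (y : eigenspace (- m) (invariants H M)) :
  dinjective M -> exists w, difference w = y.
Proof.
move=> injM.
(* In the twist [gamma] acts as theta(gamma) gamma, so its difference with 1 is theta(gamma) times
   [difference]. *)
pose y' : tw M := zscale (theta gamma) (val (val y)).
have y'D h : Delta (qproj H h) -> dact h y' = y'.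
  move=> hD; have := (twist_fix_eigenspace _).2 (ex_intro _ y erefl) h hD.
  rewrite /y' !twist_actE zscale_dact -!zscaleA [theta _ * _]mulrC zscaleA => ->.
  by [].
have [x xD xE] := gamma_sub1_surjective p_prime p_odd gamma_gen (twist_injective injM) y'D.
have [w wE] := (twist_fix_eigenspace _).1 xD.
exists w; do 2?apply: sgrp_eq; rewrite val_difference wE.
rewrite -[RHS](zscale_inv_char theta gamma) -/y' xE twist_actE qreprK.
rewrite -[RHS]/(@zscale p G M _ (_ - _ : M)) zscaleB.
by rewrite zscale_inv_char.
Qed.

(** The chosen element is unique, [val] being injective; hence the choice is additive and commutes
    with differentials. *)
Definition to_eigenspace (M : dmod p G) (z : invariants (total_subgroup G) (tw M)) :
  eigenspace (- m) (invariants H M) :=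
  sval (cid ((twist_fix_eigenspace (val z : M)).1 (fun h _ => sgrpP z h I))).

Lemma val_to_eigenspace M z : val (val (@to_eigenspace M z)) = val z.
Proof. by rewrite /to_eigenspace; case: cid. Qed.

Lemma val_eigenspaceD (M : dmod p G) (w w' : eigenspace (- m) (invariants H M)) :
  val (val (w + w')) = val (val w) + val (val w').
Proof. by rewrite val_dimageD val_invariantsD. Qed.

Lemma to_eigenspaceD M (x y : invariants (total_subgroup G) (tw M)) :
  to_eigenspace (x + y) = to_eigenspace x + to_eigenspace y.
Proof.
apply: sgrp_eq; apply: sgrp_eq; rewrite val_to_eigenspace val_invariantsD val_eigenspaceD.
by rewrite [in RHS]val_to_eigenspace [in RHS]val_to_eigenspace.
Qed.

Lemma to_eigenspace_inj M : injective (@to_eigenspace M).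
Proof.
move=> x y xy; apply: sgrp_eq.
by rewrite -[LHS]val_to_eigenspace xy val_to_eigenspace.
Qed.

Lemma difference_to_eigenspace M (z : invariants (total_subgroup G) (tw M)) :
  difference (to_eigenspace z) = 0.
Proof. by apply/difference_ker; rewrite val_to_eigenspace; exact: (sgrpP z). Qed.

Lemma difference_ker_ex M (w : eigenspace (- m) (invariants H M)) :
  difference w = 0 -> exists z, to_eigenspace z = w.
Proof.
move=> /difference_ker hw; exists (sgrp_in hw).
by apply: sgrp_eq; apply: sgrp_eq; rewrite val_to_eigenspace.
Qed.

Lemma twisted_invariants_quasi_iso (J : cplx p G) : (forall n, dinjective (J n)) ->
  exists f : cmap (forget_cplx (invariants_cplx (total_subgroup G) (twist_cplx theta J)))
      (fib (act_sub gamma (theta' gamma) (eigenspace_cplx (- m) (invariants_cplx H J)))),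
    quasi_iso f.
Proof.
move=> injJ.
apply: (@kernel_act_sub p _ gamma (theta' gamma)
  (invariants_cplx (total_subgroup G) (twist_cplx theta J))
  (eigenspace_cplx (- m) (invariants_cplx H J)) (fun n => @to_eigenspace (J n))).
- by move=> n x y; exact: to_eigenspaceD.
- move=> n x; apply: sgrp_eq; apply: sgrp_eq; transitivity (cd J n (val x)).
    exact: (val_to_eigenspace (inv_hom _ (twist_hom theta (cd J n)) x)).
  exact: (congr1 (cd J n) (esym (val_to_eigenspace x))).
- by move=> n; exact: to_eigenspace_inj.
- by move=> n x; exact: difference_to_eigenspace.
- by move=> n y; exact: difference_ker_ex.
- by move=> n z; apply: difference_surjective; exact: injJ.
Qed.

End TwistedInvariants.

(** An element of [Delta] of order p - 1 separates the powers of omega, so the exponent selected by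
    [xget] is unique. *)
Lemma omega_exponent_inv (p : nat) (p_prime : prime p) (p_odd : odd p)
    (theta : zpchar p (Gamma p)) (m : 'Z_p.-1) :
  restricts_to_omega theta m -> omega_exponent (zchar_inv theta) = - m.
Proof.
move=> tm; have inv := zchar_inv_omega p_prime p_odd tm.
apply: xget_unique => [d|k kE]; first exact: inv.
have [d Dd dinj] := Delta_generator p_prime p_odd.
have := kE d Dd; rewrite inv // => /dinj.
have lt (j : 'Z_p.-1) : (j < p.-1)%N.
  by have := ltn_ord j; rewrite [X in (_ < X)%N](Zp_cast (pred_gt1 p_prime p_odd)).
by rewrite !modn_small // => /val_inj.
Qed.

Theorem theorem2p20 (p : nat) (p_prime : prime p) (p_odd : odd p)
    (gamma : Gamma p) (gamma_gen : topological_generator gamma)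
    (A : dmod p (gal_group (QS p)))
    (A_trivial : forall (g : gal_group (QS p)) (a : A), dact g a = a)
    (theta : zpchar p (Gamma p)) (m : 'Z_p.-1)
    (theta_omega : restricts_to_omega theta m)
    (I : injective_resolution (single (twist theta A)))
    (J : injective_resolution (single A)) :
  let XA := RGamma (galH p) J in
  let F := fib (act_sub gamma (zchar_inv theta gamma)
                        (eigenspace_cplx (- m) XA)) in
  derived_equiv (forget_cplx (RGamma (total_subgroup (gal_group (QS p))) I)) F
  /\ F = cyclotomic_cone gamma (zchar_inv theta) XA.
Proof.
move=> XA F; split; last first.
  by rewrite /cyclotomic_cone (omega_exponent_inv p_prime p_odd theta_omega).
pose Jt := twist_cplx theta J.
have injJ : forall n, dinjective (J n) := @ires_injective _ _ _ J.
have injJt n : dinjective (Jt n) by apply: twist_injective; exact: injJ.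
(* [Jt] receives a quasi-isomorphism from the complex that [I] resolves; injectivity of [Jt] extends
   it to [I] up to homotopy. *)
have qg := quasi_iso_comp (twist_quasi_iso theta (@ires_quasi_iso _ _ _ J))
  (single_twist_quasi_iso theta A).
have [f qf] := extend_quasi_iso (@ires_quasi_iso _ _ _ I) qg injJt.
have qi := forget_quasi_iso (inv_quasi_iso (total_subgroup _) (@ires_injective _ _ _ I) injJt qf).
have [k qk] := twisted_invariants_quasi_iso p_prime p_odd theta_omega gamma_gen injJ.
exists F, (ccomp k (forget_cmap (inv_cmap _ f))), (cmap_id F).
by split; [exact: quasi_iso_comp qk qi|exact: quasi_iso_id].
Qed.
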